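(* Let $\alpha=(\alpha_i)_{i\in\mathbb{N}^+}\in D[0,1]$ with $\sum_{i=1}^\infty\alpha_i\leq1$ and let $A\leqslant S_\alpha$ be a subgroup. Then the character $\chi_{\nu_\alpha^A}$ of $\mathrm{Fin}(\mathbb{N})$ is indecomposable if and only if $A=S_\alpha$.
   Context: $\mathbb{N} = \{0,1,2,\dots\}$ and $\mathbb{N}^+ = \{1,2,\dots\}$. For an infinite set $\Omega$, $\mathrm{Fin}(\Omega)$ is the group of permutations $g$ of $\Omega$ with $\mathrm{supp}(g)=\{\omega \in \Omega \mid g(\omega)\neq\omega\}$ finite; $\mathrm{sgn}(\pi)\in\{\pm1\}$ is the sign of a finitary permutation $\pi$. A character of a countable group $G$ is a function $\chi:G\to\mathbb{C}$ such that (i) $\chi(hgh^{-1})=\chi(g)$ for all $g,h\in G$; (ii) $\sum_{i,j=1}^n\lambda_i\bar\lambda_j\chi(g_j^{-1}g_i)\geq0$ for all $\lambda_1,\dots,\lambda_n\in\mathbb{C}$ and $g_1,\dots,g_n\in G$; (iii) $\chi(1_G)=1$. A character $\chi$ is indecomposable if it is impossible to write $\chi=r\chi_1+(1-r)\chi_2$ with $0<r<1$ and $\chi_1\neq\chi_2$ distinct characters. For a countably infinite group $G$, $\mathrm{Sub}_G$ is the compact space of subgroups of $G$ (a closed subspace of $2^G$), on which $G$ acts by conjugation. An invariant random subgroup (IRS) of $G$ is a Borel probability measure $\nu$ on $\mathrm{Sub}_G$ which is invariant under this action. For an IRS $\nu$ of $G$, the associated character is $\chi_\nu(g)=\nu(\{H\in\mathrm{Sub}_G\mid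 g\in H\})$ for $g \in G$. $D[0,1]$ is the set of sequences $\alpha=(\alpha_1,\alpha_2,\dots)\in[0,1]^{\mathbb{N}^+}$ with $\alpha_1\geq\alpha_2\geq\cdots$. Let $\alpha\in D[0,1]$ with $\sum_{i=1}^\infty\alpha_i\leq1$. Put $\alpha_0=1-\sum_{i=1}^\infty\alpha_i$, let $p_\alpha$ be the probability measure on $\mathbb{N}$ with $p_\alpha(\{i\})=\alpha_i$, and let $\mu_\alpha$ be the corresponding product probability measure on $\mathbb{N}^{\mathbb{N}}$. $\mathrm{Fin}(\mathbb{N})$ acts on $(\mathbb{N}^{\mathbb{N}},\mu_\alpha)$ by $(g\cdot\xi)(n)=\xi(g^{-1}(n))$. For $\xi\in\mathbb{N}^{\mathbb{N}}$ and $i\in\mathbb{N}$ let $B_i^\xi=\{n\in\mathbb{N}\mid\xi(n)=i\}$. Call $\xi$ $\mu_\alpha$-generic if for all $i\in\mathbb{N}$ the following are equivalent: (a) $\alpha_i>0$; (b) $B_i^\xi\neq\emptyset$; (c) $B_i^\xi$ is infinite; (d) $\lim_{n\to\infty}|B_i^\xi\cap\{0,\dots,n-1\}|/n=\alpha_i>0$. ($\mu_\alpha$-a.e. $\xi$ is $\mu_\alpha$-generic.) Let $I=\{i\in\mathbb{N}^+\mid\alpha_i>0\}$. If $\alpha_0\neq1$ (so $I\neq\emptyset$), let $S_\alpha=\bigoplus_{i\in I}C_i$ be the restricted direct product of the multiplicative groups $C_i=\{\pm1\}$. For each subgroup $A\leqslant S_\alpha$ define $f_\alpha^A:\mathbb{N}^{\mathbb{N}}\to\mathrm{Sub}_{\mathrm{Fin}(\mathbb{N})}$,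 $\xi\mapsto H_\xi$, as follows: if $\xi$ is $\mu_\alpha$-generic then $H_\xi=s_\xi^{-1}(A)$, where $s_\xi:\bigoplus_{i\in I}\mathrm{Fin}(B_i^\xi)\to\bigoplus_{i\in I}C_i$ is the homomorphism $(\pi_i)\mapsto(\mathrm{sgn}(\pi_i))$ and $\bigoplus_{i\in I}\mathrm{Fin}(B_i^\xi)$ is regarded as a subgroup of $\mathrm{Fin}(\mathbb{N})$ in the obvious way (fixing every point outside $\bigcup_{i\in I}B_i^\xi$); otherwise $H_\xi=1$. Let $\nu_\alpha^A=(f_\alpha^A)_*\mu_\alpha$, which is an ergodic IRS of $\mathrm{Fin}(\mathbb{N})$. If $\alpha_0=1$, then $S_\alpha=1$ is the trivial group and $\nu_\alpha^{S_\alpha}=\delta_1$, the point mass at the trivial subgroup. *)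

(* Defs.v *)
From HB Require Import structures.
From mathcomp Require Import all_boot all_order all_fingroup all_algebra.
From mathcomp Require Import all_classical all_reals all_analysis.
From mathcomp Require Import measurable_realfun complex.

Set Implicit Arguments.
Unset Strict Implicit.
Unset Printing Implicit Defensive.

Import Order.TTheory GRing.Theory Num.Theory.
Import numFieldNormedType.Exports.

Local Open Scope classical_set_scope.
Local Open Scope ring_scope.

Section FinitaryPermutations.
Variable T : Type.

Definition psupp (f : T -> T) : set T := [set x | f x <> x].

(* The inverse is carried as data; it is determined by the function, see
   [finPerm_ext]. *)
Record finPerm := FinPerm {
  fp_fun :> T -> T;
  fp_inv : T -> T;
  fp_funK : cancel fp_fun fp_inv;
  fp_invK : cancel fp_inv fp_fun;
  fp_fin : finite_set (psupp fp_fun) }.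

Lemma finPerm_ext (g h : finPerm) : g =1 h -> g = h.
Proof.
case: g h => [g g' gK g'K gf] [h h' hK h'K hf] /= E.
have {}E : g = h by apply/funext.
subst h; have E' : g' = h' by apply/funext => x; rewrite -{1}(h'K x) gK.
by subst h'; congr FinPerm; exact: Prop_irrelevance.
Qed.

HB.instance Definition _ := gen_eqMixin finPerm.
HB.instance Definition _ := gen_choiceMixin finPerm.

Lemma fp1_fin : finite_set (psupp (@idfun T)).
Proof. by apply: (sub_finite_set _ (finite_set0 T)) => x. Qed.

Definition fp1 : finPerm :=
  @FinPerm idfun idfun (fun _ => erefl) (fun _ => erefl) fp1_fin.

Lemma fpV_fin (g : finPerm) : finite_set (psupp (fp_inv g)).
Proof.
apply: (sub_finite_set _ (fp_fin g)) => x /= nx gx; apply: nx.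
by rewrite -{1}gx fp_funK.
Qed.

Definition fpV (g : finPerm) : finPerm :=
  FinPerm (@fp_invK g) (@fp_funK g) (fpV_fin g).

Lemma fpM_fin (g h : finPerm) : finite_set (psupp (g \o h)).
Proof.
apply: (@sub_finite_set _ _ (psupp g `|` psupp h)).
  move=> x /= nx; apply: contrapT => /not_orP[/contrapT gx /contrapT hx].
  by apply: nx; rewrite /= hx gx.
by rewrite finite_setU; split; exact: fp_fin.
Qed.

Definition fpM (g h : finPerm) : finPerm :=
  FinPerm (can_comp (@fp_funK g) (@fp_funK h))
          (can_comp (@fp_invK h) (@fp_invK g)) (fpM_fin g h).

Lemma fpMA : associative fpM. Proof. by move=> *; exact: finPerm_ext. Qed.
Lemma fp1M : left_id fp1 fpM. Proof. by move=> *; exact: finPerm_ext. Qed.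
Lemma fpM1 : right_id fp1 fpM. Proof. by move=> *; exact: finPerm_ext. Qed.
Lemma fpVM : left_inverse fp1 fpV fpM.
Proof. by move=> g; apply: finPerm_ext => x /=; rewrite fp_funK. Qed.
Lemma fpMV : right_inverse fp1 fpV fpM.
Proof. by move=> g; apply: finPerm_ext => x /=; rewrite fp_invK. Qed.

HB.instance Definition _ := isGroup.Build finPerm fpMA fp1M fpM1 fpVM fpMV.

Lemma finPerm1 x : (1%g : finPerm) x = x. Proof. by []. Qed.
Lemma finPermM (g h : finPerm) x : (g * h)%g x = g (h x). Proof. by []. Qed.
Lemma finPermVK (g : finPerm) : cancel g (g^-1)%g. Proof. exact: fp_funK. Qed.
Lemma finPermKV (g : finPerm) : cancel (g^-1)%g g. Proof. exact: fp_invK. Qed.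

End FinitaryPermutations.

Notation "''Fin' T" := (finPerm T) (at level 8, T at level 2, format "''Fin'  T").

Section Sign.

Definition pm1 : Type := {z : int | z \is a GRing.unit}.
HB.instance Definition _ := Choice.on pm1.

Definition pm1_1 : pm1 := Sub 1 (unitr1 _).
Definition pm1V (u : pm1) : pm1 := Sub (\val u)^-1 (etrans (unitrV _) (valP u)).
Lemma pm1M_unit (u v : pm1) : \val u * \val v \is a GRing.unit.
Proof. by rewrite unitrM; apply/andP; split; exact: valP. Qed.
Definition pm1M (u v : pm1) : pm1 := Sub (\val u * \val v) (pm1M_unit u v).

Lemma pm1MA : associative pm1M.
Proof. by move=> *; apply: val_inj; rewrite /= mulrA. Qed.
Lemma pm11M : left_id pm1_1 pm1M.
Proof. by move=> *; apply: val_inj; rewrite /= mul1r. Qed.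
Lemma pm1M1 : right_id pm1_1 pm1M.
Proof. by move=> *; apply: val_inj; rewrite /= mulr1. Qed.
Lemma pm1VM : left_inverse pm1_1 pm1V pm1M.
Proof. by move=> u; apply: val_inj; rewrite /= mulVr ?(valP u). Qed.
Lemma pm1MV : right_inverse pm1_1 pm1V pm1M.
Proof. by move=> u; apply: val_inj; rewrite /= mulrV ?(valP u). Qed.

HB.instance Definition _ := isGroup.Build pm1 pm1MA pm11M pm1M1 pm1VM pm1MV.

Lemma sign_unit (b : bool) : ((-1) ^+ b : int) \is a GRing.unit.
Proof. by case: b. Qed.
Definition pm1_sign (b : bool) : pm1 := Sub ((-1) ^+ b) (sign_unit b).

Lemma pm1_signD (a b : bool) : pm1_sign (a (+) b) = (pm1_sign a * pm1_sign b)%g.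
Proof. by apply: val_inj; rewrite /= signr_addb. Qed.

Definition supp_below (n : nat) (g : 'Fin nat) := forall k, (n <= k)%N -> g k = k.

Lemma supp_belowP (g : 'Fin nat) : exists n, supp_below n g.
Proof.
have /finite_seqP[X XE] := fp_fin g.
exists (\max_(x <- X) x).+1 => k kn; apply: contrapT => nk.
have /= : [set` X] k by rewrite -XE.
by move=> /= kX; have := leq_trans kn (@leq_bigmax_seq _ X xpredT id k kX isT); rewrite ltnn.
Qed.

Lemma supp_below_lt n (g : 'Fin nat) : supp_below n g -> forall i : 'I_n, (g i < n)%N.
Proof.
move=> gn i; rewrite ltnNge; apply/negP => ngi.
have := gn _ ngi => /(can_inj (@fp_funK _ g)) gi.
by move: ngi; rewrite gi leqNgt ltn_ord.
Qed.

Definition perm_trunc_fun n (g : 'Fin nat) (gn : supp_below n g) (i : 'I_n) : 'I_n :=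
  Ordinal (supp_below_lt gn i).

Lemma perm_trunc_fun_inj n g (gn : supp_below n g) : injective (perm_trunc_fun gn).
Proof.
by move=> i j /(congr1 val)/= /(can_inj (@fp_funK _ g)) /val_inj.
Qed.

Definition perm_trunc n g (gn : supp_below n g) : {perm 'I_n} :=
  perm (@perm_trunc_fun_inj n g gn).

(* The sign of a finitary permutation of nat is that of its restriction to any
   finite initial segment containing its support, see [sgnE]. *)
Definition sgn (g : 'Fin nat) : pm1 :=
  pm1_sign (odd_perm (perm_trunc (projT2 (cid (supp_belowP g))))).

Lemma odd_truncS n g (gn : supp_below n g) (gn1 : supp_below n.+1 g) :
  odd_perm (perm_trunc gn1) = odd_perm (perm_trunc gn).
Proof.
have -> : perm_trunc gn1 = lift_perm ord_max ord_max (perm_trunc gn).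
  apply/permP => i; apply: val_inj; case: (unliftP ord_max i) => [j|] ->.
    rewrite lift_perm_lift permE /= /bump leqNgt ltn_ord /= add0n permE /=.
    by rewrite /bump leqNgt (supp_below_lt gn).
  by rewrite lift_perm_id permE /= gn.
by rewrite odd_lift_perm addbb.
Qed.

Lemma odd_trunc n m g (gn : supp_below n g) (gm : supp_below m g) :
  odd_perm (perm_trunc gm) = odd_perm (perm_trunc gn).
Proof.
wlog nm : n m gn gm / (n <= m)%N.
  by move=> H; case/orP: (leq_total n m) => [/H|/H/esym]; exact.
elim: m => [|m IH] in gm nm *.
  by case: n nm gn => // _ gn; rewrite (Prop_irrelevance gn gm).
move: nm; rewrite leq_eqVlt ltnS => /predU1P[E|nm].
  by clear IH; subst n; rewrite (Prop_irrelevance gn gm).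
have gm' : supp_below m g by move=> k mk; apply: (gn); exact: leq_trans mk.
by rewrite (odd_truncS gm') IH.
Qed.

Lemma sgnE n g (gn : supp_below n g) : sgn g = pm1_sign (odd_perm (perm_trunc gn)).
Proof. by rewrite /sgn (odd_trunc gn). Qed.

Lemma sgnM (g h : 'Fin nat) : sgn (g * h)%g = (sgn g * sgn h)%g.
Proof.
have [n gn] := supp_belowP g; have [m hm] := supp_belowP h.
have gk : supp_below (maxn n m) g.
  by move=> k; rewrite geq_max => /andP[nk _]; exact: gn.
have hk : supp_below (maxn n m) h.
  by move=> k; rewrite geq_max => /andP[_ mk]; exact: hm.
have ghk : supp_below (maxn n m) (g * h)%g.
  by move=> k kk; rewrite finPermM hk // gk.
rewrite (sgnE gk) (sgnE hk) (sgnE ghk) -pm1_signD; congr pm1_sign.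
rewrite addbC -odd_permM; congr odd_perm; apply/permP => i; apply: val_inj.
by rewrite permM !permE.
Qed.

Lemma sgn1 : sgn 1%g = 1%g.
Proof. by apply: (mulgI (sgn 1%g)); rewrite -sgnM !mulg1. Qed.

Lemma sgnV g : sgn g^-1%g = (sgn g)^-1%g.
Proof. by apply: (mulgI (sgn g)); rewrite -sgnM !mulgV sgn1. Qed.

End Sign.

(* nat -> nat with the product sigma-algebra of the discrete ones. *)
Definition coord_preimages : set (set (nat -> nat)) :=
  \bigcup_n preimage_set_system setT (fun xi : nat -> nat => xi n) measurable.

Notation seqN := (g_sigma_algebraType coord_preimages).

Section ProductMeasure.
Context {R : realType}.

Lemma measurable_coord n (B : set nat) :
  measurable ([set xi : seqN | B (xi n)]).
Proof.
apply: sub_sigma_algebra; exists n => //; exists B => //.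
by rewrite setTI.
Qed.

Lemma measurable_seqN d (T : measurableType d) (f : T -> seqN) :
  (forall n, measurable_fun setT (fun x => f x n)) -> measurable_fun setT f.
Proof.
move=> mf; apply: (@measurability _ _ _ seqN setT f coord_preimages) => //.
move=> _ [_ [n _ [B mB <-]] <-].
by rewrite setTI; have := mf n measurableT B mB; rewrite !setTI.
Qed.

Lemma measurable_box n (B : nat -> set nat) :
  measurable [set xi : seqN | forall k, (k < n)%N -> B k (xi k)].
Proof.
rewrite (_ : mkset _ = \bigcap_(k in [set k | (k < n)%N]) [set xi | B k (xi k)]) //.
by apply: bigcap_measurableType => k _; exact: measurable_coord.
Qed.

(* The product measure is obtained as the image of the Lebesgue measure on [0, 1[
   by the coding map of the piecewise affine expanding map whose i-th branch is
   onto and defined on an interval of length p [set i]. *)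
Section Coding.
Variable p : probability nat R.

Let w (i : nat) : R := fine (p [set i]).

Let pE B : (fine (p B))%:E = p B.
Proof. by rewrite fineK// fin_num_measure. Qed.

Let w_ge0 i : 0 <= w i.
Proof. by rewrite fine_ge0. Qed.

Let c (i : nat) : R := \sum_(j < i) w j.

Let cS i : c i.+1 = c i + w i.
Proof. by rewrite /c big_ord_recr. Qed.

Let c0 : c 0 = 0. Proof. by rewrite /c big_ord0. Qed.

Let c_nd i j : (i <= j)%N -> c i <= c j.
Proof.
move=> ij; rewrite -(subnK ij); elim: (j - i)%N => // k.
by rewrite addSn cS => /le_trans; apply; rewrite lerDl.
Qed.

Let c_ge0 i : 0 <= c i. Proof. by rewrite -c0 c_nd. Qed.

Let cE i : (c i)%:E = p `I_i.
Proof.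
elim: i => [|i IH]; first by rewrite c0 II0 measure0.
rewrite cS EFinD IH /w pE IIS measureU//.
by apply/seteqP; split=> x //= [+ xi]; rewrite xi ltnn.
Qed.

Let c_le1 i : c i <= 1.
Proof. by rewrite -lee_fin cE probability_le1. Qed.

Let c_gt x : x < 1 -> exists i, x < c i.
Proof.
move=> x1; apply: contrapT => H.
have cx i : c i <= x by rewrite leNgt; apply/negP => xc; apply: H; exists i.
have cvgp : p `I_n @[n --> \oo] --> p (\bigcup_n `I_n).
  apply: (@nondecreasing_cvg_mu _ _ _ p (fun n => `I_n)) => // i j ij.
  by apply/subsetPset => k /= /leq_trans; exact.
have : (p (\bigcup_n `I_n) <= x%:E)%E.
  rewrite -(cvg_lim _ cvgp)//; apply: lime_le; first by apply/cvg_ex; eexists; exact: cvgp.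
  by apply: nearW => i; rewrite -cE lee_fin.
have -> : \bigcup_n `I_n = [set: nat].
  by apply/seteqP; split => // n _; exists n.+1 => //=.
by rewrite probability_setT lee_fin leNgt x1.
Qed.

Let blk i : set R := `[c i, c i.+1[%classic.

Let d (x : R) : nat := xget 0%N [set i | blk i x].

Let blk_uniq i j x : blk i x -> blk j x -> i = j.
Proof.
rewrite /blk /= !in_itv /= => /andP[i1 i2] /andP[j1 j2].
apply/eqP; rewrite eqn_leq; apply/andP; split.
  by rewrite leqNgt; apply/negP => /c_nd /(lt_le_trans j2); rewrite ltNge i1.
by rewrite leqNgt; apply/negP => /c_nd /(lt_le_trans i2); rewrite ltNge j1.
Qed.

Let d_eq i x : blk i x -> d x = i.
Proof. by move=> bi; apply: xget_unique => // j /blk_uniq; apply. Qed.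

Let d_blk x : 0 <= x < 1 -> blk (d x) x.
Proof.
move=> /andP[x0 /c_gt ex]; have [i xi mi] := ex_minnP ex.
case: i xi mi => [|i] xi mi; first by rewrite c0 ltNge x0 in xi.
suff bi : blk i x by rewrite (d_eq bi).
rewrite /blk /= in_itv /= xi andbT leNgt; apply/negP => /mi.
by rewrite ltnn.
Qed.

Let mblk i : measurable (blk i). Proof. exact: measurable_itv. Qed.

Let md : measurable_fun setT d.
Proof.
move=> _ B _; rewrite setTI.
have -> : d @^-1` B =
   \bigcup_(i in B) blk i `|` (if 0%N \in B then ~` \bigcup_i blk i else set0).
  apply/seteqP; split=> [x /= Bx|x].
    have [[i bi]|nb] := pselect (exists i, blk i x).
      by left; exists i => //; rewrite -(d_eq bi).
    right; have dx : d x = 0%N by apply: xgetPN => i bi; apply: nb; exists i.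
    by rewrite -dx mem_set// => -[i _ bi]; apply: nb; exists i.
  case=> [[i Bi /d_eq]|] /=; first by move=> ->.
  case: ifPn => // B0 nb; have -> : d x = 0%N.
    by apply: xgetPN => i bi; apply: nb; exists i.
  exact: set_mem.
apply: measurableU; first exact: bigcup_measurable.
by case: ifPn => // _; apply: measurableC; exact: bigcup_measurable.
Qed.

Let t (x : R) : R := (x - c (d x)) / w (d x).

Let mt : measurable_fun setT t.
Proof.
apply: measurable_funM.
  apply: measurable_funB; first exact: measurable_id.
  by apply: (@measurableT_comp _ _ _ _ _ _ c _ d).
by apply: (@measurableT_comp _ _ _ _ _ _ (fun i => (w i)^-1) _ d).
Qed.

Let code (x : R) : seqN := fun n => d (iter n t x).

Let mcode : measurable_fun setT code.
Proof.
apply: measurable_seqN => n; apply: measurableT_comp => //.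
elim: n => [|n IH]; first exact: measurable_id.
exact: (measurableT_comp mt IH).
Qed.

Let code_itv n (s : nat -> nat) : exists2 a : R,
  0 <= a /\ a + \prod_(k < n) w (s k) <= 1 &
  forall x, 0 <= x < 1 -> ((forall k, (k < n)%N -> code x k = s k) <->
    a <= x < a + \prod_(k < n) w (s k)).
Proof.
elim: n s => [|n IH] s.
  exists 0; rewrite big_ord0 add0r; first by split.
  by move=> x x01; split.
have [a [a0 a1] aP] := IH (fun k => s k.+1).
rewrite big_ord_recl /=; set q := \prod_(k < n) w (s k.+1) in a1 aP.
rewrite (_ : \prod_(i < n) _ = q)//.
have q0 : 0 <= q by apply: prodr_ge0.
set i := s 0%N.
have := w_ge0 i; rewrite le_eqVlt => /orP[/eqP wi0|wi_gt0].
  exists 0; rewrite -wi0 mul0r addr0; first by split.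
  move=> x x01; split; last by move=> /andP[x0 /(le_lt_trans x0)]; rewrite ltxx.
  move=> /(_ 0%N isT) /=; rewrite /code /= => dx; have := d_blk x01.
  rewrite dx -/i /blk /= in_itv /= cS -wi0 addr0 => /andP[x0 /(le_lt_trans x0)].
  by rewrite ltxx.
have cqi : c i + w i * (a + q) <= c i.+1.
  by rewrite cS lerD2l ler_piMr // ltW.
exists (c i + w i * a); rewrite -addrA -mulrDr.
  by rewrite addr_ge0 ?mulr_ge0 // (le_trans cqi).
move=> x x01; have tE : d x = i -> (x < c i + w i * (a + q)) = (t x < a + q) /\
    (c i + w i * a <= x) = (a <= t x).
  by move=> dx; rewrite /t dx ltr_pdivrMr // ler_pdivlMr // ltrBlDl lerBrDl mulrC [a * _]mulrC.
have t01 : d x = i -> 0 <= t x < 1.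
  move=> dx; have := d_blk x01; rewrite dx /blk /= in_itv /= cS => /andP[cx xc].
  by rewrite /t dx ler_pdivlMr // mul0r subr_ge0 cx ltr_pdivrMr // mul1r ltrBlDl.
split=> [H|/andP[ax xa]].
  have dx : d x = i by apply: (H 0%N).
  have [-> ->] := tE dx; apply/(aP _ (t01 dx)) => k kn.
  by rewrite -(H k.+1) // /code iterSr.
have dx : d x = i.
  apply: d_eq; rewrite /blk /= in_itv /= (lt_le_trans xa) // andbT.
  by rewrite (le_trans _ ax) // lerDl mulr_ge0.
have [E1 E2] := tE dx; rewrite E1 in xa; rewrite E2 in ax.
move=> [|k] kn; first by rewrite /code /= dx.
rewrite /code iterSr; apply: (proj2 (aP _ (t01 dx))) => //.
by rewrite ax.
Qed.

Let base : {measure set (measurableTypeR R) -> \bar R} :=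
  mrestr (@lebesgue_measure R) (measurable_itv `[0%R, 1%R[).

Let mu : {measure set seqN -> \bar R} :=
  measure_function_pushforward__canonical__measure_function_Measure base mcode.

Let mu_cyl n (s : nat -> nat) :
  mu [set xi | forall k, (k < n)%N -> xi k = s k] = (\prod_(k < n) p [set s k])%E.
Proof.
have [a [a0 a1] aP] := code_itv n s.
have -> : (\prod_(k < n) p [set s k] = (\prod_(k < n) w (s k))%:E)%E.
  by rewrite -prodEFin; apply: eq_bigr => k _; rewrite pE.
set q := \prod_(k < n) _ in a1 aP *.
have q0 : 0 <= q by apply: prodr_ge0.
transitivity (@lebesgue_measure R `[a, (a + q)[%classic).
  congr lebesgue_measure; apply/seteqP; split => x /=; rewrite !in_itv /=.
    by case=> H /aP [h _]; apply: h.
  move=> /andP[ax xq].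
  have x01 : 0 <= x < 1 by rewrite (le_trans a0) //= (lt_le_trans xq).
  by split => //; apply: (proj2 (aP _ x01)); rewrite ax.
rewrite lebesgue_measure_itv /= lte_fin ltrDl -EFinD addrAC subrr add0r.
case: ifPn => //; rewrite -leNgt => q0'; congr EFin; apply/eqP.
by rewrite eq_le q0.
Qed.

Let mu_box_aux m n (C : nat -> set nat) :
  (forall k, (m <= k < n)%N -> exists i, C k = [set i]) ->
  mu [set xi | forall k, (k < n)%N -> C k (xi k)] = (\prod_(k < n) p (C k))%E.
Proof.
elim: m C => [|m IH] C H.
  have /choice[s sP] : forall k, exists i, (k < n)%N -> C k = [set i].
    move=> k; have [/(H k)[i Ci]|_] := boolP (k < n)%N; first by exists i.
    by exists 0%N.
  transitivity (\prod_(k < n) p [set s k])%E.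
    rewrite -mu_cyl; congr (mu _); apply/seteqP.
    by split => xi /= H' k kn; have := H' k kn; rewrite sP.
  by apply: eq_bigr => k _; rewrite sP.
have [mn|nm] := ltnP m n; last first.
  by apply: IH => k /andP[mk kn]; have := leq_trans nm mk; rewrite leqNgt kn.
pose D i k := if k == m then [set i] else C k.
have DE i : mu [set xi | forall k, (k < n)%N -> D i k (xi k)] =
    (\prod_(k < n) p (D i k))%E.
  apply: IH => k /andP[mk kn]; rewrite /D; case: eqVneq => [_|km].
    by exists i.
  by apply: H; rewrite kn andbT ltn_neqAle eq_sym km.
have -> : [set xi : seqN | forall k, (k < n)%N -> C k (xi k)] =
    \bigcup_(i in C m) [set xi | forall k, (k < n)%N -> D i k (xi k)].
  apply/seteqP; split=> [xi /= Cxi|xi [i Ci /= Dxi] k kn].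
    exists (xi m); first exact: Cxi.
    by move=> k kn; rewrite /D; case: eqVneq => [->//|_]; exact: Cxi.
  by have := Dxi k kn; rewrite /D; case: eqVneq => [->|//] /= ->.
rewrite measure_bigcup; last 2 first.
- by move=> i _; exact: measurable_box.
- move=> i j _ _ [xi [/= /(_ m mn) + /(_ m mn)]].
  by rewrite /D eqxx /= => -> ->.
pose q := (\prod_(k < n | k != Ordinal mn) fine (p (C k)))%R.
have prodE (E : nat -> set nat) : (forall k, k != m -> E k = C k) ->
    (\prod_(k < n) p (E k) = q%:E * p (E m))%E.
  move=> EC; rewrite (bigD1 (Ordinal mn)) //= muleC; congr (_ * _)%E.
  by rewrite -prodEFin; apply: eq_bigr => k km; rewrite pE EC.
rewrite prodE //.
under eq_eseriesr => i _.
  rewrite DE prodE; last by move=> k /negbTE km; rewrite /D km.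
  rewrite {1}/D eqxx.
  over.
rewrite nneseriesZl //; congr (_ * _)%E.
rewrite -measure_bigcup //.
- by congr (p _); apply/seteqP; split=> [i [j Cj ->]//|i Ci]; exists i.
- by move=> i j _ _ [k [/= -> ->]].
Qed.

Lemma product_probability_exists : exists P : probability seqN R,
  forall n (B : nat -> set nat),
  P [set xi | forall k, (k < n)%N -> B k (xi k)] = (\prod_(k < n) p (B k))%E.
Proof.
have mu1 : mu setT = 1%E.
  have := mu_cyl 0 id; rewrite big_ord0 => <-.
  by congr (mu _); apply/seteqP; split.
pose P : probability seqN R := HB.pack (Measure.sort mu)
  (Measure_isProbability.Build _ _ _ (Measure.sort mu) mu1).
exists P => n B; apply: (@mu_box_aux n n B) => k /andP[nk kn].
by rewrite leqNgt kn in nk.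
Qed.

End Coding.

(* [product_probabilityE] on finite-dimensional boxes characterizes the measure. *)
Definition product_probability (p : probability nat R) : probability seqN R :=
  projT1 (cid (product_probability_exists p)).

Lemma product_probabilityE (p : probability nat R) n (B : nat -> set nat) :
  product_probability p [set xi | forall k, (k < n)%N -> B k (xi k)] =
  (\prod_(k < n) p (B k))%E.
Proof. exact: (projT2 (cid (product_probability_exists p))). Qed.

End ProductMeasure.

Section Subgroups.
Variable G : groupType.

Record subgroup := Subgroup {
  subgroup_set :> set G;
  subgroup_1 : subgroup_set 1%g;
  subgroup_M : forall x y,
    subgroup_set x -> subgroup_set y -> subgroup_set (x * y)%g;
  subgroup_V : forall x, subgroup_set x -> subgroup_set x^-1%g }.

Lemma trivial_subgroup_M (x y : G) :
  [set 1%g] x -> [set 1%g] y -> [set 1%g] (x * y)%g.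
Proof. by move=> -> ->; rewrite /= mulg1. Qed.

Lemma trivial_subgroup_V (x : G) : [set 1%g] x -> [set 1%g] x^-1%g.
Proof. by move=> ->; rewrite /= invg1. Qed.

Definition trivial_subgroup : subgroup :=
  @Subgroup [set 1%g] erefl trivial_subgroup_M trivial_subgroup_V.

HB.instance Definition _ := gen_eqMixin subgroup.
HB.instance Definition _ := gen_choiceMixin subgroup.
HB.instance Definition _ := isPointed.Build subgroup trivial_subgroup.

(* The topology induced by the inclusion in 2^G. *)
Definition subgroup_char (H : subgroup) : {ptws G -> bool} := fun g => `[< subgroup_set H g >].

HB.instance Definition _ :=
  Topological.copy subgroup (initial_topology subgroup_char).

End Subgroups.

Notation SubG G := (g_sigma_algebraType (@open (subgroup G))).

Section Characters.
Variables (R : realType) (G : groupType).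

Record is_character (chi : G -> R[i]) : Prop := IsCharacter {
  character_conj : forall g h : G, chi (h * g * h^-1)%g = chi g;
  character_pos : forall n (l : 'I_n -> R[i]) (g : 'I_n -> G),
    0 <= \sum_(i < n) \sum_(j < n) l i * (l j)^* * chi ((g j)^-1 * g i)%g;
  character_1 : chi 1%g = 1 }.

Definition indecomposable_character (chi : G -> R[i]) : Prop :=
  is_character chi /\
  ~ exists (r : R) (chi1 chi2 : G -> R[i]),
      [/\ 0 < r < 1, is_character chi1, is_character chi2, chi1 <> chi2 &
          chi = (fun g => r%:C * chi1 g + (1 - r)%:C * chi2 g)]%C.

(* chi_nu(g) = nu {H | g \in H} *)
Definition irs_character (nu : set (SubG G) -> \bar R) (g : G) : R[i] :=
  (fine (nu [set H : SubG G | subgroup_set H g]))%:C%C.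

End Characters.

Section DirectPower.
Variables (J : Type) (G : groupType).

(* The restricted direct product of copies of G indexed by J. *)
Record dpower := Dpower {
  dpower_fun :> J -> G;
  dpower_fin : finite_set [set j | dpower_fun j <> 1%g] }.

Lemma dpower_ext (s t : dpower) : s =1 t -> s = t.
Proof.
case: s t => [s sf] [t tf] /= /funext E; subst t.
by congr Dpower; exact: Prop_irrelevance.
Qed.

HB.instance Definition _ := gen_eqMixin dpower.
HB.instance Definition _ := gen_choiceMixin dpower.

Lemma dpower1_fin : finite_set [set j : J | (1%g : G) <> 1%g].
Proof. by apply: (sub_finite_set _ (finite_set0 J)) => j. Qed.
Definition dpower1 : dpower := Dpower dpower1_fin.

Lemma dpowerM_fin (s t : dpower) : finite_set [set j | (s j * t j)%g <> 1%g].
Proof.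
apply: (@sub_finite_set _ _ ([set j | s j <> 1%g] `|` [set j | t j <> 1%g])).
  move=> j /= nj; apply: contrapT => /not_orP[/contrapT sj /contrapT tj].
  by apply: nj; rewrite sj tj mulg1.
by rewrite finite_setU; split; exact: dpower_fin.
Qed.
Definition dpowerM (s t : dpower) : dpower := Dpower (dpowerM_fin s t).

Lemma dpowerV_fin (s : dpower) : finite_set [set j | (s j)^-1%g <> 1%g].
Proof.
apply: (sub_finite_set _ (dpower_fin s)) => j /= nj sj; apply: nj.
by rewrite sj invg1.
Qed.
Definition dpowerV (s : dpower) : dpower := Dpower (dpowerV_fin s).

Lemma dpowerMA : associative dpowerM.
Proof. by move=> *; apply: dpower_ext => j /=; rewrite mulgA. Qed.
Lemma dpower1M : left_id dpower1 dpowerM.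
Proof. by move=> *; apply: dpower_ext => j /=; rewrite mul1g. Qed.
Lemma dpowerM1 : right_id dpower1 dpowerM.
Proof. by move=> *; apply: dpower_ext => j /=; rewrite mulg1. Qed.
Lemma dpowerVM : left_inverse dpower1 dpowerV dpowerM.
Proof. by move=> *; apply: dpower_ext => j /=; rewrite mulVg. Qed.
Lemma dpowerMV : right_inverse dpower1 dpowerV dpowerM.
Proof. by move=> *; apply: dpower_ext => j /=; rewrite mulgV. Qed.

HB.instance Definition _ :=
  isGroup.Build dpower dpowerMA dpower1M dpowerM1 dpowerVM dpowerMV.

End DirectPower.

Section Statement.
Variable R : realType.

Definition D01 : set (nat -> R) :=
  [set a | (forall n, 0 <= a n <= 1) /\ forall n, a n.+1 <= a n].

(* A sequence alpha_1 >= alpha_2 >= ... in D[0,1] of sum at most 1; the index is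
   shifted, the n-th term being alpha_{n+1}. *)
Record subprob_seq := SubprobSeq {
  subprob_fun :> nat -> R;
  subprob_D01 : D01 subprob_fun;
  subprob_sum : (\sum_(0 <= n <oo) (subprob_fun n)%:E <= 1)%E }.

Variable alpha : subprob_seq.

(* weight i is alpha_i for every i in nat, with alpha_0 = 1 - sum_{i >= 1} alpha_i. *)
Definition weight (i : nat) : R :=
  if i is j.+1 then alpha j
  else 1 - fine (\sum_(0 <= n <oo) (alpha n)%:E)%E.

Lemma subprob_ge0 n : 0 <= alpha n.
Proof. by have [/(_ n)/andP[]] := subprob_D01 alpha. Qed.

Lemma subprob_sum_ge0 : (0 <= \sum_(0 <= n <oo) (alpha n)%:E)%E.
Proof. by apply: nneseries_ge0 => n _ _; rewrite lee_fin subprob_ge0. Qed.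

Lemma subprob_sum_fin : (\sum_(0 <= n <oo) (alpha n)%:E)%E \is a fin_num.
Proof.
rewrite ge0_fin_numE ?subprob_sum_ge0 //; apply: le_lt_trans (subprob_sum alpha) _.
by rewrite ltry.
Qed.

Lemma weight_ge0 i : 0 <= weight i.
Proof.
case: i => [|j] /=; last exact: subprob_ge0.
by rewrite subr_ge0 -lee_fin fineK ?subprob_sum_fin // subprob_sum.
Qed.

Definition p_alpha_measure : {measure set nat -> \bar R} :=
  mseries (fun i => mscale (NngNum (weight_ge0 i)) \d_i) 0.

Lemma p_alpha_measureE i : p_alpha_measure [set i] = (weight i)%:E.
Proof.
rewrite /p_alpha_measure /= /mseries (@nneseriesD1 _ _ i) //.
rewrite [X in (_ + X)%E]eseries0 ?adde0.
  transitivity ((weight i)%:E * \d_i [set i])%E; first by [].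
  by rewrite diracE mem_set // mule1.
move=> j _ /= ji; transitivity ((weight j)%:E * \d_j [set i])%E; first by [].
rewrite diracE memNset ?mule0 //.
by move=> /= E; rewrite E eqxx in ji.
Qed.

Lemma p_alpha_measureT : p_alpha_measure [set: nat] = 1%E.
Proof.
transitivity ((weight 0)%:E + \sum_(0 <= k <oo) (alpha k)%:E)%E; last first.
  by rewrite /= EFinB fineK ?subeK ?subprob_sum_fin.
rewrite /p_alpha_measure /= /mseries.
rewrite (@eq_eseriesr _ _ (fun i => (weight i)%:E)); last first.
  move=> i _; transitivity ((weight i)%:E * \d_i [set: nat])%E; first by [].
  by rewrite diracT mule1.
apply/cvg_lim => //; rewrite -cvg_shiftS.
rewrite (_ : (fun _ => _) = fun n =>
    ((weight 0)%:E + \sum_(0 <= k < n) (alpha k)%:E)%E); last first.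
  by apply/funext => n; rewrite big_nat_recl.
apply: cvgeD; first exact: fin_num_adde_defr.
  exact: cvg_cst.
by apply: is_cvg_nneseries => n _ _; rewrite lee_fin subprob_ge0.
Qed.

Definition p_alpha : probability nat R :=
  HB.pack (Measure.sort p_alpha_measure)
    (Measure_isProbability.Build _ _ _ (Measure.sort p_alpha_measure) p_alpha_measureT).

Definition mu_alpha : probability seqN R := product_probability p_alpha.

Definition block (xi : nat -> nat) (i : nat) : set nat := [set n | xi n = i].

Definition block_freq (xi : nat -> nat) (i n : nat) : R :=
  #|[pred k : 'I_n | xi k == i]|%:R / n%:R.

Definition generic (xi : nat -> nat) : Prop := forall i,
  [<-> 0 < weight i : Prop;
       block xi i !=set0;
       infinite_set (block xi i);
       block_freq xi i n @[n --> \oo] --> weight i /\ 0 < weight i].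

(* The set I of the i >= 1 with alpha_i > 0. *)
Definition pos_index : Type := {i : nat | (0 < i)%N && (0 < weight i)}.

Definition S_alpha : groupType := dpower pos_index pm1.

(* Fin(B_i) is identified with the finitary permutations of nat supported in B_i;
   an element of the restricted direct product of the Fin(B_i), i in I, is then a
   finitely supported family pi : I -> Fin(nat) such that [block_family xi pi],
   and [block_sum xi pi] is its image in Fin(nat). *)
Definition block_family (xi : nat -> nat) (pi : dpower pos_index ('Fin nat)) : Prop :=
  forall i : pos_index, psupp (pi i) `<=` block xi (val i).

Definition block_sum (xi : nat -> nat) (pi : pos_index -> 'Fin nat) (n : nat) : nat :=
  if insub (xi n) is Some i then pi i n else n.

Lemma block_signs_fin (pi : dpower pos_index ('Fin nat)) :
  finite_set [set i | sgn (pi i) <> 1%g].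
Proof.
apply: (sub_finite_set _ (dpower_fin pi)) => i /= ni pii; apply: ni.
by rewrite pii sgn1.
Qed.

Definition block_signs (pi : dpower pos_index ('Fin nat)) : S_alpha :=
  Dpower (block_signs_fin pi).

(* s_xi is [block_signs] on block families, so [sign_preimage] is s_xi^-1(A). *)
Section Preimage.
Variables (A : subgroup S_alpha) (xi : nat -> nat).

Definition sign_preimage : set ('Fin nat) :=
  [set g : 'Fin nat | exists pi : dpower pos_index ('Fin nat),
     [/\ block_family xi pi, g =1 block_sum xi pi & subgroup_set A (block_signs pi)]].

Lemma block_family_stable pi i n : block_family xi pi ->
  block xi (val i) n -> block xi (val i) (pi i n).
Proof.
move=> pix bn; have [->//|nn] := pselect (pi i n = n).
by apply: pix => /= /(can_inj (@fp_funK _ (pi i))).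
Qed.

Lemma block_family_1 : block_family xi 1%g.
Proof. by move=> i n; apply: contra_notP. Qed.

Lemma block_family_M p q :
  block_family xi p -> block_family xi q -> block_family xi (p * q)%g.
Proof.
move=> px qx i n; apply: contra_notP => nb.
have qn : q i n = n by apply: contrapT => /(qx i).
have pn : p i n = n by apply: contrapT => /(px i).
by rewrite [LHS]finPermM qn pn.
Qed.

Lemma block_family_V p : block_family xi p -> block_family xi p^-1%g.
Proof.
move=> px i n; apply: contra_notP => nb.
have pn : p i n = n by apply: contrapT => /(px i).
by rewrite -[in LHS]pn; exact: finPermVK.
Qed.

Lemma block_sum1 n : block_sum xi (1%g : dpower pos_index ('Fin nat)) n = n.
Proof. by rewrite /block_sum; case: insubP. Qed.

Lemma block_sumM (p q : dpower pos_index ('Fin nat)) n : block_family xi q ->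
  block_sum xi (p * q)%g n = block_sum xi p (block_sum xi q n).
Proof.
move=> qx; rewrite /block_sum; case E: (insub (xi n)) => [i|]; last by rewrite E.
have bn : block xi (val i) n.
  by move: E; case: insubP => // j _ /esym jx [<-].
have bq : xi (q i n) = val i := block_family_stable qx bn.
by rewrite bq valK.
Qed.

Lemma sign_preimage_1 : sign_preimage 1%g.
Proof.
exists 1%g; split; first exact: block_family_1.
- by move=> n; rewrite block_sum1.
- rewrite (_ : block_signs _ = 1%g); first exact: subgroup_1.
  by apply: dpower_ext => i; exact: sgn1.
Qed.

Lemma sign_preimage_M g h :
  sign_preimage g -> sign_preimage h -> sign_preimage (g * h)%g.
Proof.
move=> [p [px gp Ap]] [q [qx hq Aq]]; exists (p * q)%g; split.
- exact: block_family_M.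
- by move=> n; rewrite finPermM hq gp block_sumM.
- rewrite (_ : block_signs _ = (block_signs p * block_signs q)%g).
    exact: subgroup_M.
  by apply: dpower_ext => i; exact: sgnM.
Qed.

Lemma sign_preimage_V g : sign_preimage g -> sign_preimage g^-1%g.
Proof.
move=> [p [px gp Ap]]; exists p^-1%g; split; first exact: block_family_V.
- move=> n; apply: (can_inj (finPermVK g)).
  rewrite finPermKV gp -block_sumM; last exact: block_family_V.
  by rewrite mulgV block_sum1.
- rewrite (_ : block_signs _ = (block_signs p)^-1%g).
    exact: subgroup_V.
  by apply: dpower_ext => i; exact: sgnV.
Qed.

Definition sign_preimage_subgroup : subgroup ('Fin nat) :=
  Subgroup sign_preimage_1 sign_preimage_M sign_preimage_V.

End Preimage.

Definition f_alpha (A : subgroup S_alpha) (xi : seqN) : SubG ('Fin nat) :=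
  if `[< generic xi >] then sign_preimage_subgroup A xi
  else trivial_subgroup ('Fin nat).

Definition nu_alpha (A : subgroup S_alpha) : set (SubG ('Fin nat)) -> \bar R :=
  if weight 0 == 1 then \d_(trivial_subgroup ('Fin nat) : SubG ('Fin nat))
  else pushforward mu_alpha (f_alpha A).

End Statement.

(* Main.v *)
Require Import Defs.
From mathcomp Require Import all_boot all_order all_fingroup all_algebra.
From mathcomp Require Import all_classical all_reals all_analysis.
From mathcomp Require Import complex ring lra zify.

Import Order.TTheory GRing.Theory Num.Theory.
Import numFieldNormedType.Exports.

Local Open Scope classical_set_scope.

(** Write chi_A(g) for the probability, under mu_alpha, that g lies in
    s_xi^{-1}(A).  Almost every sequence is generic, so chi_A is the character of
    nu_alpha^A; when alpha_0 = 1 both are the indicator of the identity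
    ([irs_character_nu_alpha]).  Membership of g in s_xi^{-1}(A) depends on xi
    only through its restriction to the support of g, so these events are cylinder
    events, to which the product formula for mu_alpha applies directly.

    If A is the whole group S_alpha, membership says that g preserves the level
    sets of xi and moves only points of blocks of positive index.  For g and h with
    disjoint supports these conditions concern disjoint sets of coordinates, hence
    chi(gh) = chi(g) chi(h) ([sign_prob_mul]).  A real character with this property
    is indecomposable ([multiplicative_component_eq]): take N conjugates g_i of g
    with disjoint supports and put y = (g_1 + ... + g_N)/N in the group algebra.
    Multiplicativity gives chi((y - chi(g))^* (y - chi(g))) = (1 - chi(g)^2)/N.  If
    chi = r chi_1 + (1 - r) chi_2, then r chi_1 is dominated by chi as a positive
    functional, and by Cauchy-Schwarz r |chi_1(g) - chi(g)|^2 is at most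
    (1 - chi(g)^2)/N for every N; hence chi_1(g) = chi(g), and likewise for chi_2.

    If A is a proper subgroup, it misses some generator d_i of S_alpha, the element
    with sign -1 at i only ([generators_full]).  As S_alpha has exponent 2, the
    union A' of A and d_i A is a subgroup in which A has index 2, and
    chi_A = (1/2) chi_A' + (1/2) (2 chi_A - chi_A').  The second term is again a
    character ([sign_prob_diff_character]): pointwise in xi it comes from the
    function equal to 1 on a subgroup H, to -1 on the rest of an overgroup in which
    H has index at most 2, and to 0 elsewhere, and this function is positive
    definite ([signed_indicator_ge0]).  The two terms differ at the transposition
    (0 1), since with probability at least alpha_i^2 > 0 both 0 and 1 lie in the
    i-th block, where (0 1) has sign vector d_i
    ([extension_sign_prob_neq]).

    That almost every sequence is generic is the strong law of large numbers for
    indicator variables; it follows from a Chernoff bound and the Borel-Cantelli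
    lemma ([chernoff], [deviation_io], [nongeneric_null]). *)

(** * Cylinder events of the product measure *)

Section CylinderEvents.
Local Open Scope ring_scope.
Set Implicit Arguments.
Unset Strict Implicit.

Definition box (n : nat) (B : nat -> set nat) : set seqN :=
  [set xi : seqN | forall k, (k < n)%N -> B k (xi k)].

(** The bound n keeps the set of relevant coordinates finite, so that the
    events below are countable unions of boxes. *)
Definition depends_on (n : nat) (X : pred nat) (E : set seqN) :=
  forall xi xi' : seqN, (forall k, (k < n)%N -> X k -> xi k = xi' k) -> E xi -> E xi'.

Definition point_box n (X : pred nat) (v : nat -> nat) : set seqN :=
  box n (fun k => if X k then [set v k] else setT).

(** Sorting the points of E by their finitely many relevant coordinates, which
    are encoded by a single natural number, cuts E into countably many disjoint
    pieces.  A nonempty piece is a whole box because E does not see the other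
    coordinates.  Countable additivity then reduces statements on the measure of
    E to boxes. *)
Lemma depends_on_boxes n X E : depends_on n X E ->
  exists F : nat -> set seqN, [/\ trivIset setT F, E = \bigcup_i F i &
    forall i, F i = set0 \/ exists v, F i = point_box n X v].
Proof.
move=> EX.
pose code (xi : seqN) := pickle [seq if X k then xi k else 0%N | k <- iota 0 n].
have codeE xi xi' : code xi = code xi' <-> forall k, (k < n)%N -> X k -> xi k = xi' k.
  split=> [/(pcan_inj pickleK)/eq_in_map H k kn Xk|H].
    by have := H k; rewrite mem_iota /= kn Xk; apply.
  congr pickle; apply/eq_in_map => k; rewrite mem_iota /= => kn.
  by case: ifP => // /(H k kn).
(* Irrelevant coordinates are encoded as 0, so that they do not split pieces. *)
exists (fun i => E `&` [set xi | code xi = i]); split.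
- by move=> i j _ _ [xi [[_ /= <-] [_ /= <-]]].
- by apply/seteqP; split=> [xi Exi|xi [i _ []//]]; exists (code xi).
- move=> i; have [->|/set0P[v [Ev /= vi]]] := eqVneq (E `&` [set xi | code xi = i]) set0.
    by left.
  right; exists v; rewrite -vi; apply/seteqP; split=> xi.
    by move=> [_ /= /codeE H] k kn /=; case: ifP => // /(H k kn).
  move=> H; have H' k : (k < n)%N -> X k -> v k = xi k.
    by move=> kn Xk; have /= := H k kn; rewrite Xk.
  by split; [exact: EX Ev | apply/codeE => k kn Xk; rewrite H'].
Qed.

Lemma depends_on_measurable n X E : depends_on n X E -> measurable E.
Proof.
move=> /depends_on_boxes[F [_ -> FB]]; apply: bigcup_measurable => i _.
by case: (FB i) => [->|[v ->]]; [exact: measurable0 | exact: measurable_box].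
Qed.

Context {R : realType} (p : probability nat R).
Local Notation P := (product_probability p).

Lemma box_prob n B : P (box n B) = (\prod_(k < n) p (B k))%E.
Proof. exact: product_probabilityE. Qed.

(** The intersection is the box whose k-th side is the intersection of the k-th
    sides; one of these is everything, so the product formula factors. *)
Lemma point_box_indep n (X Y : pred nat) v w : (forall k, X k -> ~~ Y k) ->
  P (point_box n X v `&` point_box n Y w) = (P (point_box n X v) * P (point_box n Y w))%E.
Proof.
move=> XY; rewrite /point_box !box_prob.
rewrite (_ : _ `&` _ = box n (fun k =>
    (if X k then [set v k] else setT) `&` (if Y k then [set w k] else setT))).
  rewrite box_prob -big_split /=; apply: eq_bigr => k _.
  case: ifP => [/XY/negbTE ->|_]; rewrite ?setIT ?setTI probability_setT ?mule1 //.
  by rewrite mul1e.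
apply/seteqP; split=> xi.
  by move=> [H1 H2] k kn; split; [exact: H1|exact: H2].
by move=> H; split=> k kn; have [] := H k kn.
Qed.

Lemma bigcup_indep (F : nat -> set seqN) (C : set seqN) :
  (forall i, measurable (F i)) -> measurable C -> trivIset setT F ->
  (forall i, P (F i `&` C) = P (F i) * P C)%E ->
  P ((\bigcup_i F i) `&` C) = (P (\bigcup_i F i) * P C)%E.
Proof.
move=> mF mC tF FC; rewrite setI_bigcupl measure_bigcup //; last 2 first.
- by move=> i _; exact: measurableI.
- by move=> i j _ _ [x [[Fi _] [Fj _]]]; apply: (tF i j) => //; exists x.
rewrite measure_bigcup // muleC -(fineK (fin_num_measure P C mC)) -nneseriesZl //.
by apply: eq_eseriesr => i _; rewrite fineK ?fin_num_measure // muleC; exact: FC.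
Qed.

Lemma depends_on_indep n (X Y : pred nat) E F : (forall k, X k -> ~~ Y k) ->
  depends_on n X E -> depends_on n Y F -> P (E `&` F) = (P E * P F)%E.
Proof.
move=> XY EX FY.
have mpb Z v : measurable (point_box n Z v) by exact: measurable_box.
have [F0 [tF FE FB]] := depends_on_boxes FY.
have [E0 [tE EE EB]] := depends_on_boxes EX.
have mE0 i : measurable (E0 i) by case: (EB i) => [->|[v ->]].
have mF0 i : measurable (F0 i) by case: (FB i) => [->|[v ->]].
rewrite EE; apply: bigcup_indep => //; first exact: depends_on_measurable FY.
move=> i; rewrite setIC muleC FE; apply: bigcup_indep => // j.
case: (FB j) => [->|[w ->]]; first by rewrite set0I measure0 mul0e.
case: (EB i) => [->|[v ->]]; first by rewrite setI0 measure0 mule0.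
by rewrite setIC muleC point_box_indep.
Qed.

Lemma point_box_perm n (X : pred nat) (v : nat -> nat) (h : 'Fin nat) : supp_below n h ->
  P [set xi : seqN | point_box n X v (xi \o h)] = P (point_box n X v).
Proof.
move=> hn; have hVn : supp_below n h^-1%g.
  by move=> k /hn hk; rewrite -{1}hk finPermVK.
pose B k := if X k then [set v k] else setT.
rewrite [in RHS](_ : point_box n X v = box n B) // box_prob.
rewrite (_ : [set _ | _] = box n (B \o h^-1%g)).
  rewrite box_prob /= (reindex_inj (@perm_inj _ (perm_trunc hn))) /=.
  apply: eq_bigr => k _; congr (p (B _)).
  by rewrite permE; exact: (finPermVK h).
apply/seteqP; split=> xi H k kn /=.
  have /= := H _ (supp_below_lt hVn (Ordinal kn)); rewrite /= /B.
  by rewrite finPermKV.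
have := H _ (supp_below_lt hn (Ordinal kn)).
by rewrite /= /B fp_funK.
Qed.

(** This is what makes chi_A a class function. *)
Lemma depends_on_perm n X E (h : 'Fin nat) : depends_on n X E ->
  supp_below n h ->
  P [set xi : seqN | E (xi \o h)] = P E.
Proof.
move=> EX hn; have [F [tF -> FB]] := depends_on_boxes EX.
have mh (C : set seqN) : measurable C -> measurable [set xi : seqN | C (xi \o h)].
  move=> mC; have mf : measurable_fun setT (fun xi : seqN => (xi \o h) : seqN).
    by apply: measurable_seqN => k _ B mB; rewrite setTI; exact: (measurable_coord (h k) B).
  by have := mf measurableT C mC; rewrite setTI.
have mF i : measurable (F i).
  by case: (FB i) => [->|[v ->]]; [exact: measurable0 | exact: measurable_box].
rewrite (_ : [set _ | _] = \bigcup_i [set xi : seqN | F i (xi \o h)]) //.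
rewrite [RHS]measure_bigcup // measure_bigcup //; last 2 first.
- by move=> i _; exact: mh.
- by move=> i j _ _ [xi [/= Fi Fj]]; apply: (tF i j) => //; exists (xi \o h).
apply: eq_eseriesr => i _; case: (FB i) => [->|[v ->]]; last exact: point_box_perm.
by rewrite measure0.
Qed.

End CylinderEvents.

(** * Almost every sequence is generic *)

Section FiniteFibers.
Local Open Scope ring_scope.
Set Implicit Arguments.
Unset Strict Implicit.

Lemma fine_measure_fibers d (T : measurableType d) (R : realType) (P : probability T R)
    (J : finType) (f : T -> J) (Q : pred J) :
  (forall j, measurable (f @^-1` [set j])) ->
  fine (P [set x | Q (f x)]) = \sum_(j | Q j) fine (P (f @^-1` [set j])).
Proof.
move=> mf; rewrite sum_fine; last by move=> j _; exact: fin_num_measure.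
congr fine; rewrite -big_enum /= fsbig_seq ?enum_uniq //=.
rewrite -measure_fin_bigcup //; last by move=> i j _ _ [x [/= -> ->]].
congr (P _); apply/seteqP; split=> [x /= Qx|x [j /=]].
  by exists (f x) => //=; rewrite mem_enum.
by rewrite mem_enum => Qj ->.
Qed.

End FiniteFibers.

Section Chernoff.
Local Open Scope ring_scope.
Set Implicit Arguments.
Unset Strict Implicit.

Context {R : realType} (p : probability nat R).
Local Notation P := (product_probability p).

Definition tally n (B : pred nat) (xi : nat -> nat) : nat := #|[pred k : 'I_n | B (xi k)]|.

(** Take inverses in exp(-t) >= 1 - t. *)
Lemma expR_le_quad (t : R) : 0 <= t <= 1 / 2 -> expR t <= 1 + t + 2 * t ^+ 2.
Proof.
move=> /andP[t0 t1].
have t1' : 0 < 1 - t by lra.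
have : (expR t)^-1 >= 1 - t by rewrite -expRN; exact: expR_ge1Dx.
rewrite -[X in X <= _ -> _]invrK lef_pV2 ?posrE ?invr_gt0 ?expR_gt0 // => /le_trans; apply.
rewrite -[X in X <= _]mul1r ler_pdivrMr //.
nra.
Qed.

(** Exponential Markov inequality with parameter t = e/4.  The law of the pattern
    of hits of B among the first n coordinates is an explicit product, so the
    exponential moment is a finite sum that factors as the n-th power of
    w exp(t) + 1 - w; this is at most exp(w (exp(t) - 1)), and
    [expR_le_quad] bounds the total exponent per coordinate by
    2 t^2 - t e = - e^2/8. *)
Lemma chernoff (B : pred nat) n (e : R) : 0 < e <= 1 ->
  fine (P [set xi : seqN | n%:R * (fine (p [set x | B x]) + e) <= (tally n B xi)%:R]) <=
  expR (- (e ^+ 2 / 8)) ^+ n.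
Proof.
move=> /andP[e0 e1]; set w := fine (p _).
have w0 : 0 <= w by rewrite fine_ge0.
have w1 : w <= 1 by rewrite -lee_fin fineK ?fin_num_measure // probability_le1.
pose pat (xi : seqN) : {ffun 'I_n -> bool} := [ffun k : 'I_n => B (xi k)].
pose wt (b : bool) := if b then w else 1 - w.
have patE (b : {ffun 'I_n -> bool}) : pat @^-1` [set b] =
    box n (fun k => [set x | B x = (if insub k is Some i then b i else false)]).
  apply/seteqP; split=> xi /=.
    by move=> <- k kn; rewrite insubT ffunE.
  move=> H; apply/ffunP => k; rewrite ffunE.
  by have /= := H k (ltn_ord k); rewrite valK.
have patP (b : {ffun 'I_n -> bool}) : fine (P (pat @^-1` [set b])) = \prod_k wt (b k).
  rewrite patE box_prob; apply: EFin_inj; rewrite fineK; last first.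
    by apply: prode_fin_num => k _; exact: fin_num_measure.
  rewrite -prodEFin; apply: eq_bigr => k _; rewrite valK /wt.
  case: (b k); first by rewrite fineK ?fin_num_measure.
  rewrite (_ : mkset _ = ~` [set x | B x]); last first.
    by apply/seteqP; split=> x /=; case: (B x).
  by rewrite probability_setC // EFinB fineK ?fin_num_measure.
pose t := e / 4.
have t01 : 0 <= t <= 1 / 2 by rewrite /t; lra.
pose c (b : {ffun 'I_n -> bool}) : R := \sum_(k < n) (b k)%:R.
have tallyE xi : (tally n B xi)%:R = c (pat xi).
  rewrite /tally /c -sum1_card natr_sum big_mkcond /=.
  by apply: eq_bigr => k _; rewrite ffunE inE; case: (B _).
rewrite (_ : mkset _ = [set xi | n%:R * (w + e) <= c (pat xi)]); last first.
  by apply/seteqP; split=> xi /=; rewrite tallyE.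
rewrite (@fine_measure_fibers _ _ _ P _ pat (fun b => n%:R * (w + e) <= c b)); last first.
  by move=> b; rewrite patE; exact: measurable_box.
have wt0 b : 0 <= wt b by rewrite /wt; case: b; lra.
(* The indicator of the event is at most exp(t (c b - n (w + e))). *)
apply: (@le_trans _ _ (\sum_(b : {ffun 'I_n -> bool})
    expR (- (t * (n%:R * (w + e)))) * \prod_k (expR (t * (b k)%:R) * wt (b k)))).
  rewrite big_mkcond; apply: ler_sum => b _; rewrite big_split /=.
  have prod0 : 0 <= \prod_(k < n) wt (b k) by exact: prodr_ge0.
  case: ifP => [cb|_]; last first.
    by rewrite !mulr_ge0 ?expR_ge0 //; apply: prodr_ge0 => k _; exact: expR_ge0.
  rewrite patP mulrA -expR_sum -expRD ler_peMl // -[leLHS]expR0 ler_expR.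
  rewrite -mulr_sumr addrC subr_ge0 ler_wpM2l //.
  by case/andP: t01.
rewrite -mulr_sumr -(bigA_distr_bigA (fun (_ : 'I_n) (b : bool) => expR (t * b%:R) * wt b)) /=.
rewrite big_bool /= prodr_const card_ord /wt mulr1 mulr0 expR0 mul1r.
rewrite mulrCA -mulrN expRM_natl -exprMn lerXn2r ?nnegrE ?mulr_ge0 ?expR_ge0 //.
  by rewrite addr_ge0 ?mulr_ge0 ?expR_ge0 //; lra.
have H1 : expR t * w + (1 - w) <= expR (w * (expR t - 1)).
  by apply: le_trans (expR_ge1Dx _); lra.
apply: (le_trans (ler_wpM2l (expR_ge0 _) H1)).
rewrite -expRD ler_expR.
have := expR_le_quad t01; rewrite /t.
set E := expR _ => HE.
have : w * (E - 1 - e / 4) <= 2 * (e / 4) ^+ 2.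
  have h : E - 1 - e / 4 <= 2 * (e / 4) ^+ 2 by lra.
  apply: le_trans (ler_wpM2l w0 h) _.
  by rewrite ler_piMl // mulr_ge0 // sqr_ge0.
nra.
Qed.

Lemma depends_on_tally n B (Q : nat -> Prop) : depends_on n predT [set xi | Q (tally n B xi)].
Proof.
move=> xi xi' H /=; rewrite /tally (@eq_card _ _ [pred k : 'I_n | B (xi' k)]) // => k.
by rewrite !inE H.
Qed.

Lemma measurable_tally n B (Q : nat -> Prop) : measurable [set xi : seqN | Q (tally n B xi)].
Proof. exact: depends_on_measurable (@depends_on_tally n B Q). Qed.

Lemma tallyC n B xi : (tally n B xi + tally n (predC B) xi)%N = n.
Proof. by rewrite /tally -[RHS]card_ord -(cardC [pred k : 'I_n | B (xi k)]). Qed.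

Definition deviation (B : pred nat) (e : R) (n : nat) : set seqN :=
  [set xi | e <= `| (tally n B xi)%:R / n%:R - fine (p [set x | B x]) |].

Lemma measurable_deviation B e n : measurable (deviation B e n).
Proof. exact: (@measurable_tally n B (fun m => _ <= `|m%:R / _ - _|)). Qed.

End Chernoff.

Section Deviations.
Local Open Scope ring_scope.
Set Implicit Arguments.
Unset Strict Implicit.

Context {R : realType} (p : probability nat R).
Local Notation P := (product_probability p).

(** A deviation by e is an excess of hits of B or of its complement, so
    [chernoff] is used twice. *)
Lemma deviation_prob B e n : 0 < e <= 1 ->
  (P (deviation p B e n) <= (2 * expR (- (e ^+ 2 / 8)) ^+ n)%:E)%E.
Proof.
move=> e01; have mt := @measurable_tally.
rewrite -[P _]fineK; last by apply: fin_num_measure; exact: measurable_deviation.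
rewrite lee_fin mulr_natl mulr2n.
apply: le_trans (lerD (chernoff p B n e01) (chernoff p (predC B) n e01)).
set w := fine (p [set x | B x]).
have -> : fine (p [set x | predC B x]) = 1 - w.
  rewrite (_ : mkset _ = ~` [set x | B x]); last first.
    by apply/seteqP; split=> x /=; case: (B x).
  by rewrite probability_setC // fineB ?fin_num_measure.
set U := mkset _; set V := mkset _.
have mU : measurable U by exact: (mt n B (fun m => _ <= m%:R)).
have mV : measurable V by exact: (mt n (predC B) (fun m => _ <= m%:R)).
rewrite -fineD ?fin_num_measure // fine_le ?fin_num_measure //.
- exact: measurable_deviation.
- by rewrite fin_numD !fin_num_measure.
apply: le_trans (measureU2 _ mU mV); apply: le_measure; rewrite ?inE.
- exact: measurable_deviation.
- exact: measurableU.
move=> xi; rewrite /deviation /U /V /= -/w.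
have := congr1 (fun m => m%:R : R) (tallyC n B xi); rewrite natrD.
set a : R := _%:R; set b : R := _%:R => abn.
have [->|n0] := eqVneq n 0%N; first by rewrite !mul0r => _; left.
have n0' : (0 : R) < n%:R by rewrite ltr0n lt0n.
have an : a = a / n%:R * n%:R by rewrite divfK ?gt_eqF.
rewrite ler_normr => /orP[H|H]; [left|right].
  by rewrite an mulrC ler_pM2r //; lra.
rewrite (_ : b = (1 - a / n%:R) * n%:R); last by rewrite mulrBl -an mul1r -abn addrC addKr.
by rewrite mulrC ler_pM2r //; lra.
Qed.

Lemma deviation_io B e : 0 < e <= 1 -> P (lim_sup_set (deviation p B e)) = 0%E.
Proof.
move=> e01; apply: lim_sup_set_cvg0; first by move=> k; exact: measurable_deviation.
set q := expR (- (e ^+ 2 / 8)).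
have e0 : 0 < e by case/andP: e01.
have q0 : 0 < q by exact: expR_gt0.
have q1 : q < 1 by rewrite expR_lt1 oppr_lt0 divr_gt0 // exprn_gt0.
apply: (@le_lt_trans _ _ (2 / (1 - q))%:E); last exact: ltry.
apply: lime_le; first by apply: is_cvg_nneseries => n _ _; exact: measure_ge0.
apply: nearW => n; apply: (@le_trans _ _ (series (geometric 2 q) n)%:E).
  rewrite /series /= -sumEFin; apply: lee_sum => k _; exact: deviation_prob.
rewrite lee_fin; apply: geometric_le_lim => //.
by rewrite gtr0_norm.
Qed.

Definition frequency_fails (B : pred nat) : set seqN :=
  \bigcup_k lim_sup_set (deviation p B (k.+1%:R^-1)).

(** Convergence needs to be tested only on the tolerances 1/(k+1); this exhibits
    the failure set as a countable combination of tally events, hence as a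
    measurable set. *)
Lemma frequency_failsP B (xi : seqN) : ~ frequency_fails B xi <->
  (tally n B xi)%:R / n%:R @[n --> \oo] --> fine (p [set x | B x]).
Proof.
rewrite /frequency_fails; set w := fine _; split=> [H|/cvgrPdist_lt cv [k _ lk]].
  apply/cvgrPdist_lt => e e0.
  have [k ke] : exists k : nat, k.+1%:R^-1 < e.
    by exists (Num.truncn e^-1); rewrite invf_plt ?posrE // truncnS_gt.
  have : ~ lim_sup_set (deviation p B (k.+1%:R^-1)) xi by move=> lk; apply: H; exists k.
  move=> /existsNP[N /not_implyP[_ NN]]; exists N => // n /= Nn.
  rewrite distrC ltNge; apply/negP => en; apply: NN; exists n => //=.
  by rewrite /deviation /= -/w (le_trans (ltW ke)).
have [N _ HN] := cv k.+1%:R^-1 (ltac:(by rewrite invr_gt0)).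
have [n /= Nn] := lk N I; rewrite /deviation /= -/w distrC leNgt.
by rewrite HN.
Qed.

Lemma frequency_fails_measurable B : measurable (frequency_fails B).
Proof.
apply: bigcup_measurable => k _; apply: bigcap_measurable => // n _.
by apply: bigcup_measurable => j _; exact: measurable_deviation.
Qed.

Lemma frequency_fails_null B : P.-negligible (frequency_fails B).
Proof.
apply: negligible_bigcup => k; apply/negligibleP.
  apply: bigcap_measurable => // n _.
  by apply: bigcup_measurable => j _; exact: measurable_deviation.
by apply: deviation_io; rewrite invr_gt0 ltr0n /= invf_le1 ?ltr0n // ler1n.
Qed.

End Deviations.

Section Generic.
Local Open Scope ring_scope.
Set Implicit Arguments.
Unset Strict Implicit.

Context {R : realType} (alpha : subprob_seq R).

(** A finite block has frequency at most its cardinal divided by n, which tends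
    to 0. *)
Lemma infinite_block_of_frequency (xi : nat -> nat) i (w : R) : 0 < w ->
  block_freq R xi i n @[n --> \oo] --> w -> infinite_set (block xi i).
Proof.
move=> w0 /cvgrPdist_lt/(_ (w / 2))[|N _ HN]; first by rewrite divr_gt0.
move=> /finite_seqP[s bs]; pose n := (N + (Num.truncn (2 * (size s)%:R / w)).+1)%N.
have n0 : (0 : R) < n%:R by rewrite ltr0n /n addnS.
have := HN n; rewrite /= leq_addr => /(_ isT); apply/negP; rewrite -leNgt.
have sz : (#|[pred k : 'I_n | xi k == i]| <= size s)%N.
  rewrite cardE -(size_map val); apply: uniq_leq_size.
    by rewrite map_inj_uniq ?enum_uniq //; exact: val_inj.
  move=> _ /mapP[k + ->]; rewrite mem_enum inE => /eqP xik.
  have : block xi i k by [].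
  by rewrite bs.
have bn : block_freq R xi i n <= w / 2 :> R.
  rewrite /block_freq ler_pdivrMr // (@le_trans _ _ (size s)%:R) ?ler_nat //.
  have : 2 * (size s)%:R / w <= n%:R.
    by rewrite (le_trans (ltW (truncnS_gt _))) // ler_nat leq_addl.
  rewrite ler_pdivrMr //; lra.
by rewrite ger0_norm ?lerBrDl; lra.
Qed.

(** The four conditions of genericity collapse: for an index of positive weight
    the limit of the frequencies implies the others, and for an index of weight 0
    all of them fail as soon as the block is empty. *)
Lemma genericP (xi : nat -> nat) : generic alpha xi <->
  forall i, if 0 < weight alpha i then block_freq R xi i n @[n --> \oo] --> weight alpha i
    else ~ (block xi i !=set0).
Proof.
split=> gx i.
  have G := gx i; case: ifP => w0; first by have [] := (G 0%N 3%N).1 w0.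
  by move=> b0; have := (G 1%N 0%N).1 b0; rewrite w0.
have := gx i; case: ifP => w0 H.
  have inf := infinite_block_of_frequency w0 H.
  tfae => // _; exact: infinite_setN0.
tfae=> // [inf|[_]//].
by case: H; exact: infinite_setN0 inf.
Qed.

Definition nongeneric_at i : set seqN :=
  if 0 < weight alpha i then frequency_fails (p_alpha alpha) (pred1 i)
  else \bigcup_n [set xi : seqN | xi n = i].

Lemma nongenericE : ~` [set xi : seqN | generic alpha xi] = \bigcup_i nongeneric_at i.
Proof.
have pE i : fine (p_alpha alpha [set x | pred1 i x]) = weight alpha i.
  rewrite (_ : mkset _ = [set i]); first by rewrite -[LHS]/(fine (p_alpha_measure alpha [set i])) p_alpha_measureE.
  by apply/seteqP; split=> x /= /eqP.
apply/seteqP; split=> xi.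
  move=> ng; apply: contrapT => H; apply: ng; apply/genericP => i.
  have {H} : ~ nongeneric_at i xi by move=> H'; apply: H; exists i.
  rewrite /nongeneric_at; case: ifP => w0.
    by move=> /frequency_failsP; rewrite pE.
  by move=> H [n xn]; apply: H; exists n.
move=> [i _]; rewrite /nongeneric_at => H /genericP/(_ i); case: ifP H => w0 H.
  by move=> cv; move: H; apply/frequency_failsP; rewrite pE.
by apply; have [n _ xn] := H; exists n.
Qed.

Lemma nongeneric_at_measurable i : measurable (nongeneric_at i).
Proof.
rewrite /nongeneric_at; case: ifP => _; first exact: frequency_fails_measurable.
by apply: bigcup_measurable => n _; exact: (measurable_coord n [set i]).
Qed.

Lemma generic_measurable : measurable [set xi : seqN | generic alpha xi].
Proof.
rewrite -[mkset _]setCK nongenericE; apply: measurableC.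
by apply: bigcup_measurable => i _; exact: nongeneric_at_measurable.
Qed.

Lemma nongeneric_null : mu_alpha alpha (~` [set xi : seqN | generic alpha xi]) = 0%E.
Proof.
apply/negligibleP; first exact: measurableC generic_measurable.
rewrite nongenericE; apply: negligible_bigcup => i; rewrite /nongeneric_at.
case: ifPn => [_|w0]; first exact: frequency_fails_null.
apply: negligible_bigcup => n; apply/negligibleP.
  exact: (measurable_coord n [set i]).
rewrite (_ : mkset _ = box n.+1 (fun k => if k == n then [set i] else setT)).
  apply: (etrans (box_prob (p_alpha alpha) _ _)); rewrite (bigD1 ord_max) //= eqxx.
  rewrite -[X in (X * _)%E]/(p_alpha_measure alpha [set i]) p_alpha_measureE.
  have -> : weight alpha i = 0.
    by apply/eqP; rewrite eq_le weight_ge0 andbT leNgt.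
  by rewrite mul0e.
apply/seteqP; split=> xi /=.
  by move=> xn k _; case: eqP => // ->.
by move=> /(_ n (leqnn _)); rewrite eqxx.
Qed.

End Generic.

(** * Positive definiteness *)

Section Positivity.
Local Open Scope ring_scope.
Set Implicit Arguments.
Unset Strict Implicit.

(** An expectation computed as a finite sum: the left-hand side is the average of
    the pointwise sums over the atoms of the finite algebra generated by the
    events, and only nonempty atoms contribute. *)
Lemma expectation_ge0 d (T : measurableType d) (R : realType) (P : probability T R)
    (J : finType) (E : J -> set T) (c : J -> R[i]) :
  (forall j, measurable (E j)) ->
  (forall x, 0 <= \sum_j c j * (`[< E j x >])%:R) ->
  0 <= \sum_j c j * (fine (P (E j)))%:C%C.
Proof.
move=> mE cE; pose pat x : {ffun J -> bool} := [ffun j => `[< E j x >]].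
have mpat b : measurable (pat @^-1` [set b]).
  rewrite (_ : _ @^-1` _ = \bigcap_(j in [set: J]) (if b j then E j else ~` E j)).
    apply: fin_bigcap_measurable => // j _; case: ifP => // _; exact: measurableC.
  apply/seteqP; split=> x /=.
    move=> <- j _; rewrite ffunE; case: asboolP => //.
  move=> H; apply/ffunP => j; rewrite ffunE; have := H j I.
  by case: (b j) => /= H'; [apply/asboolP | apply/asboolPn].
pose m b : R := fine (P (pat @^-1` [set b])).
have PE j : fine (P (E j)) = \sum_(b : {ffun J -> bool}) m b * (b j)%:R.
  rewrite (_ : E j = [set x | pat x j]); last first.
    by apply/seteqP; split=> x /=; rewrite ffunE => /asboolP.
  rewrite (@fine_measure_fibers _ _ _ P _ pat (fun b => b j)) // big_mkcond /=.
  by apply: eq_bigr => b _; case: (b j); rewrite ?mulr1 ?mulr0.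
have -> : \sum_j c j * (fine (P (E j)))%:C%C =
    \sum_b (m b)%:C%C * \sum_j c j * (b j)%:R.
  under eq_bigr => j _ do rewrite PE rmorph_sum mulr_sumr.
  rewrite exchange_big; apply: eq_bigr => b _; rewrite mulr_sumr.
  by apply: eq_bigr => j _; rewrite rmorphM /= mulrCA; congr (_ * (_ * _)); case: (b j).
apply: sumr_ge0 => b _; have [[x bx]|nx] := pselect (exists x, pat x = b).
  apply: mulr_ge0; first by rewrite lecR fine_ge0.
  rewrite -bx; under eq_bigr => j _ do rewrite ffunE; exact: cE.
rewrite /m (_ : _ @^-1` _ = set0) ?measure0 ?mul0r //.
by apply/seteqP; split=> x //= bx; apply: nx; exists x.
Qed.

Section Kernel.
Variables (G : groupType) (HS HS' : subgroup G).
Local Notation H := (subgroup_set HS).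
Local Notation H' := (subgroup_set HS').
Hypothesis HH' : forall x, H x -> H' x.
Hypothesis index2 : forall x y, H' x -> ~ H x -> H' y -> ~ H y -> H (x * y)%g.

(** For H of index 2 in H' this is the sign character of H'/H extended by 0; for
    H = H' it is the indicator of H. *)
Definition signed_indicator (x : G) : int := 2 * (`[< H x >])%:Z - (`[< H' x >])%:Z.
Local Notation K := signed_indicator.

Lemma signed_indicator_out x : ~ H' x -> K x = 0.
Proof.
move=> nx; rewrite /K; case: asboolP => [/HH'//|_]; by case: asboolP.
Qed.

Lemma subgroup_cancelr (L : subgroup G) x y :
  subgroup_set L y -> subgroup_set L (x * y)%g -> subgroup_set L x.
Proof. by move=> Ly /subgroup_M/(_ (subgroup_V Ly)); rewrite mulgK. Qed.

Lemma subgroup_cancell (L : subgroup G) x y :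
  subgroup_set L x -> subgroup_set L (x * y)%g -> subgroup_set L y.
Proof. by move=> /subgroup_V Lx /(subgroup_M Lx); rewrite mulKg. Qed.

Lemma signed_indicatorM x y : H' x -> H' y -> K (x * y)%g = K x * K y.
Proof.
move=> hx hy; have hxy : H' (x * y)%g by exact: subgroup_M.
rewrite /K (asboolT hx) (asboolT hy) (asboolT hxy).
case: (asboolP (H x)) => Hx; case: (asboolP (H y)) => Hy.
- by rewrite (asboolT (subgroup_M Hx Hy)).
- by rewrite asboolF // => /(subgroup_cancell Hx).
- by rewrite asboolF // => /(subgroup_cancelr Hy).
- by rewrite asboolT //; exact: index2.
Qed.

Lemma signed_indicatorV x : K x^-1%g = K x.
Proof.
have V (L : subgroup G) : `[< subgroup_set L x^-1%g >] = `[< subgroup_set L x >].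
  apply: asbool_equiv_eq; split=> [/subgroup_V|/subgroup_V//]; by rewrite invgK.
by rewrite /K !V.
Qed.

(** The matrix of values K(g_j^{-1} g_i) is a Gram matrix.  Group the indices by
    the cosets g_i H' and choose a representative r in each class; since K is
    multiplicative on H', the entry at (i, j) is
    K(g_r^{-1} g_i) K(g_r^{-1} g_j) when i and j are both in the class of r, and 0
    when they are in different classes. *)
Lemma signed_indicator_ge0 (C : numClosedFieldType) n (l : 'I_n -> C) (g : 'I_n -> G) :
  0 <= \sum_(i < n) \sum_(j < n) l i * (l j)^* * (K ((g j)^-1 * g i)%g)%:~R.
Proof.
pose sim i j := `[< H' ((g j)^-1 * g i)%g >].
have simxx i : sim i i by apply/asboolP; rewrite mulVg; exact: subgroup_1.
have symT i j k : sim i j -> sim k i = sim k j.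
  move=> /asboolP hij; apply: asbool_equiv_eq.
  have e : ((g j)^-1 * g i * ((g i)^-1 * g k) = (g j)^-1 * g k)%g by rewrite mulgA mulgK.
  split=> [hki|]; first by rewrite -e; exact: subgroup_M.
  by rewrite -e; exact: subgroup_cancell.
have simC i j : sim i j = sim j i.
  apply: asbool_equiv_eq; split=> /subgroup_V; by rewrite invMg invgK.
pose rep i := [pick k | sim i k].
pose u i k : int := if rep i == Some k then K ((g k)^-1 * g i)%g else 0.
(* u i k is the k-th coordinate of the Gram vector of i: it vanishes unless k
   represents the class of i. *)
have KE i j : K ((g j)^-1 * g i)%g = \sum_k u i k * u j k.
  have [sij|nsij] := boolP (sim i j).
    have repE : rep i = rep j.
      by apply: eq_pick => k; rewrite ![sim _ k]simC (symT _ _ _ sij).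
    have : rep j = rep j by []; rewrite {2}/rep; case: pickP => [r jr rj|/(_ j)]; last first.
      by rewrite simxx.
    have ir : sim i r by rewrite simC (symT _ _ _ sij) simC.
    rewrite (bigD1 r) //= big1 ?addr0; last first.
      by move=> k kr; rewrite /u repE rj (inj_eq Some_inj) eq_sym (negbTE kr) mul0r.
    rewrite /u repE rj eqxx mulrC -(signed_indicatorV ((g r)^-1 * g j)) -signed_indicatorM.
    - by rewrite invMg invgK mulgA mulgK.
    - by apply: subgroup_V; apply/asboolP.
    - by apply/asboolP.
  rewrite signed_indicator_out; last by move=> h; move/negP: nsij; apply; apply/asboolP.
  apply/esym; apply: big1 => k _; rewrite /u.
  have [ik|_] := eqVneq (rep i) (Some k); last by rewrite mul0r.
  have [jk|_] := eqVneq (rep j) (Some k); last by rewrite mulr0.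
  have simrep m : rep m = Some k -> sim m k by rewrite /rep; case: pickP => // r mr [<-].
  by rewrite (symT _ _ i (simrep j jk)) (simrep i ik) in nsij.
have -> : \sum_(i < n) \sum_(j < n) l i * (l j)^* * (K ((g j)^-1 * g i)%g)%:~R =
    \sum_k (\sum_i l i * (u i k)%:~R) * (\sum_i l i * (u i k)%:~R)^*.
  transitivity (\sum_i \sum_j \sum_k (l i * (u i k)%:~R) * (l j * (u j k)%:~R)^*).
    apply: eq_bigr => i _; apply: eq_bigr => j _.
    rewrite KE rmorph_sum mulr_sumr; apply: eq_bigr => k _ /=.
    by rewrite rmorphM rmorphM /= rmorph_int; ring.
  under eq_bigr => i _ do rewrite exchange_big.
  rewrite exchange_big; apply: eq_bigr => k _ /=.
  rewrite mulr_suml; apply: eq_bigr => i _.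
  by rewrite rmorph_sum mulr_sumr.
by apply: sumr_ge0 => k _; exact: mul_conjC_ge0.
Qed.
End Kernel.

End Positivity.

(** * The sign events and their characters *)

Section SignEvents.
Local Open Scope ring_scope.
Set Implicit Arguments.
Unset Strict Implicit.

Lemma supp_below_ge n m (g : 'Fin nat) : (n <= m)%N -> supp_below n g -> supp_below m g.
Proof. by move=> nm gn k mk; apply: gn; exact: leq_trans mk. Qed.

Lemma supp_below_moved n (g : 'Fin nat) k : supp_below n g -> g k != k -> (k < n)%N.
Proof. by move=> gn; apply: contraNT; rewrite -leqNgt => /gn ->. Qed.

Context {R : realType} (alpha : subprob_seq R).
Implicit Type A : subgroup (S_alpha alpha).

Lemma block_sum_moved (xi : nat -> nat) (pi : dpower (pos_index alpha) ('Fin nat)) i n :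
  block_family xi pi -> pi i n <> n -> block_sum xi pi n = pi i n.
Proof. by move=> pix /(pix i) /= xn; rewrite /block_sum xn valK. Qed.

Definition sign_event A (g : 'Fin nat) : set seqN := [set xi | sign_preimage A xi g].

(** A family representing g for xi consists of permutations moving only points
    moved by g, so it still represents g for any sequence that agrees with xi on
    the support of g. *)
Lemma depends_on_sign_event A n g : supp_below n g ->
  depends_on n [pred k | g k != k] (sign_event A g).
Proof.
move=> gn xi xi' xixi' [pi [pix gpi Api]]; exists pi.
have moved i k : pi i k <> k -> g k != k.
  by move=> pk; apply/eqP; rewrite gpi (block_sum_moved pix pk).
have eqxi k : g k != k -> xi k = xi' k.
  by move=> gk; apply: xixi' => //; exact: supp_below_moved gk.
split=> //.
  by move=> i k /= pk; have := pix i k pk; rewrite /block /= => <-; rewrite eqxi ?(moved i).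
move=> k; have [gk|/negPn/eqP gk] := boolP (g k != k).
  by rewrite gpi /block_sum eqxi.
rewrite gk /block_sum; case: insubP => // i _ _; apply: contrapT => H.
have /moved : pi i k <> k by move=> E; apply: H; rewrite E.
by rewrite gk eqxx.
Qed.

Lemma measurable_sign_event A g : measurable (sign_event A g).
Proof.
have [n gn] := supp_belowP g.
exact: depends_on_measurable (depends_on_sign_event gn).
Qed.

(** The character chi_A of the overview, as a real-valued function. *)
Definition sign_prob A g : R := fine (mu_alpha alpha (sign_event A g)).

Lemma sign_prob1 A : sign_prob A 1%g = 1.
Proof.
rewrite /sign_prob (_ : sign_event A 1%g = setT) ?probability_setT //.
by apply/seteqP; split=> // xi _; exact: sign_preimage_1.
Qed.

Lemma pm1_conj (u v : pm1) : (u * v * u^-1)%g = v.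
Proof.
apply: val_inj => /=; rewrite mulrAC mulrV ?mul1r //; exact: valP.
Qed.

(** Conjugate the family representing g by h; conjugation does not change
    signs. *)
Lemma sign_preimage_conj A (xi : nat -> nat) (g h : 'Fin nat) :
  sign_preimage A (xi \o h) g -> sign_preimage A xi (h * g * h^-1)%g.
Proof.
move=> [pi [pix gpi Api]].
have fin : finite_set [set i | (h * pi i * h^-1)%g <> 1%g].
  apply: (sub_finite_set _ (dpower_fin pi)) => i /=; apply: contra_not => ->.
  by rewrite mulg1 mulgV.
exists (Dpower fin); split.
- move=> i n /= nn; have pin : pi i (h^-1%g n) <> h^-1%g n.
    move=> E; apply: nn; rewrite -[LHS]/(h (pi i (h^-1%g n))) E; exact: finPermKV.
  have := pix i _ pin; rewrite /block /= => <-; congr xi; exact/esym/finPermKV.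
- move=> n; rewrite !finPermM gpi /block_sum /= [h (fp_inv h n)]fp_invK.
  by case: insubP => // *; exact: fp_invK.
- rewrite (_ : block_signs _ = block_signs pi) //.
  by apply: dpower_ext => i /=; rewrite !sgnM sgnV pm1_conj.
Qed.

Lemma sign_prob_conj A g h : sign_prob A (h * g * h^-1)%g = sign_prob A g.
Proof.
have [n gn] := supp_belowP g; have [m hm] := supp_belowP h.
have gk := supp_below_ge (leq_maxl n m) gn; have hk := supp_below_ge (leq_maxr n m) hm.
rewrite /sign_prob -[in RHS](depends_on_perm _ (depends_on_sign_event gk) hk).
congr (fine (mu_alpha _ _)); apply/seteqP; split=> xi /=; last exact: sign_preimage_conj.
rewrite /sign_event /= => H.
have : sign_preimage A (xi \o h) (h^-1 * (h * g * h^-1) * h^-1^-1)%g.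
  apply: sign_preimage_conj; rewrite (_ : (xi \o h) \o h^-1%g = xi) //.
  by apply/funext => k /=; rewrite fp_invK.
by rewrite !mulgA mulVg mul1g invgK mulgKV.
Qed.

(** If alpha_0 = 1 the other weights sum to 0, so S_alpha is trivial. *)
Lemma pos_index_trivial : weight alpha 0 = 1 -> pos_index alpha -> False.
Proof.
move=> w1 [[|j] //= jpos].
have : ((alpha j)%:E <= 0)%E.
  have -> : 0%E = (\sum_(0 <= n <oo) (alpha n)%:E)%E.
    rewrite -[RHS]fineK ?subprob_sum_fin //; congr EFin.
    by move: w1 => /= /(congr1 (fun x => 1 - x)); rewrite opprB addrC subrK subrr.
  apply: le_trans (nneseries_lim_ge j.+1 _); last first.
    by move=> n _ _; rewrite lee_fin subprob_ge0.
  rewrite big_nat_recr //= leeDr // sume_ge0 // => n _.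
  by rewrite lee_fin subprob_ge0.
by rewrite lee_fin leNgt jpos.
Qed.

(** The trivial subgroup that replaces s_xi^{-1}(A) at nongeneric sequences
    changes the event on a null set only. *)
Lemma irs_character_nu_alpha A g : irs_character (nu_alpha A) g = (sign_prob A g)%:C%C.
Proof.
rewrite /irs_character /sign_prob; congr (fine _)%:C%C; rewrite /nu_alpha.
case: ifP => [/eqP w1|_].
  have -> : sign_event A g = [set xi | g = 1%g].
    apply/seteqP; split=> xi /=; last by move=> ->; exact: sign_preimage_1.
    move=> [pi [_ gpi _]]; apply: finPerm_ext => n; rewrite gpi /block_sum.
    by case: insubP => // i; case: (pos_index_trivial w1 i).
  rewrite diracE.
  have [->|g1] := pselect (g = 1%g).
    rewrite mem_set //= (_ : [set _ | _] = setT) ?probability_setT //.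
    by apply/seteqP; split.
  rewrite memNset //= (_ : [set _ | _] = set0) ?measure0 //.
  by apply/seteqP; split.
set Gen := [set xi : seqN | generic alpha xi].
have mG : measurable Gen := generic_measurable alpha.
have mN : measurable (~` Gen) by exact: measurableC.
have N0 : mu_alpha alpha (~` Gen) = 0%E := nongeneric_null alpha.
have mE := measurable_sign_event A g.
rewrite /pushforward; set F := _ @^-1` _.
have FE : F = (sign_event A g `&` Gen) `|` (if g == 1%g then ~` Gen else set0).
  rewrite /F /f_alpha; apply/seteqP; split=> xi /=.
    case: asboolP => gx /= H; first by left.
    by right; rewrite H eqxx.
  case=> [[H gx]|]; first by rewrite asboolT.
  by case: eqP => // -> gx; rewrite asboolF.
have mF : measurable F.
  by rewrite FE; apply: measurableU; [exact: measurableI|case: ifP].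
rewrite -(measureU0 mF mN N0) -(measureU0 mE mN N0); congr (mu_alpha _ _).
rewrite FE; apply/seteqP; split=> xi.
  move=> [[[Ex _]|]|]; [by left| |by right].
  by case: ifP => // _; right.
by move=> [Ex|]; [|by right]; have [gx|gx] := pselect (Gen xi); [left; left|right].
Qed.

(** Positivity holds before integration, by [signed_indicator_ge0] applied to
    s_xi^{-1}(A) inside s_xi^{-1}(A'), whose index is at most 2.  The case A = A'
    says that chi_A itself is a character. *)
Lemma sign_prob_diff_character A A' :
  (forall x, subgroup_set A x -> subgroup_set A' x) ->
  (forall x y, subgroup_set A' x -> ~ subgroup_set A x -> subgroup_set A' y ->
     ~ subgroup_set A y -> subgroup_set A (x * y)%g) ->
  is_character (fun g => (2 * sign_prob A g - sign_prob A' g)%:C%C).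
Proof.
move=> AA' index2; split.
- by move=> g h; rewrite !sign_prob_conj.
- move=> n l g.
  (* The boolean selects one of the two subgroups, so that [expectation_ge0]
     treats all the events as one finite family. *)
  pose J := (('I_n * 'I_n) * bool)%type.
  pose E (j : J) := sign_event (if j.2 then A else A') ((g j.1.2)^-1 * g j.1.1)%g.
  pose c (j : J) : R[i] := l j.1.1 * (l j.1.2)^* * (if j.2 then 2 else -1).
  have mE j : measurable (E j) by exact: measurable_sign_event.
  have split2 (f : subgroup (S_alpha alpha) -> 'Fin nat -> R[i]) :
      \sum_(j : J) c j * f (if j.2 then A else A') ((g j.1.2)^-1 * g j.1.1)%g =
      \sum_i \sum_j l i * (l j)^* * (2 * f A ((g j)^-1 * g i)%g - f A' ((g j)^-1 * g i)%g).
    rewrite pair_bigA /= -(pair_bigA _ (fun ij b => c (ij, b) *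
      f (if b then A else A') ((g ij.2)^-1 * g ij.1)%g)) /=.
    apply: eq_bigr => -[i j] _; rewrite big_bool /c /=; ring.
  have := @expectation_ge0 _ _ _ (mu_alpha alpha) J E c mE.
  rewrite (split2 (fun B x => (fine (mu_alpha alpha (sign_event B x)))%:C%C)).
  rewrite (_ : (\sum_i \sum_j _) = \sum_(i < n) \sum_(j < n)
      l i * (l j)^* * (2 * sign_prob A ((g j)^-1 * g i)%g - sign_prob A' ((g j)^-1 * g i)%g)%:C%C).
    apply=> xi.
    rewrite (split2 (fun B x => (`[< sign_event B x xi >])%:R)).
    pose H (B : subgroup (S_alpha alpha)) := sign_preimage_subgroup B xi.
    have HH' x : subgroup_set (H A) x -> subgroup_set (H A') x.
      by move=> [pi [? ? /AA']]; exists pi.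
    have H2 x y : subgroup_set (H A') x -> ~ subgroup_set (H A) x ->
        subgroup_set (H A') y -> ~ subgroup_set (H A) y -> subgroup_set (H A) (x * y)%g.
      move=> [p [px gp Ap]] nx [q [qx hq Aq]] ny; exists (p * q)%g; split.
      - exact: block_family_M.
      - by move=> n'; rewrite finPermM hq gp block_sumM.
      - rewrite (_ : block_signs _ = (block_signs p * block_signs q)%g); last first.
          by apply: dpower_ext => i; exact: sgnM.
        apply: index2 => // [H'|H'].
          by apply: nx; exists p.
        by apply: ny; exists q.
    have := signed_indicator_ge0 HH' H2 l g.
    rewrite (_ : (\sum_i \sum_j _) = \sum_(i < n) \sum_(j < n) l i * (l j)^* *
      (2 * (`[< sign_event A ((g j)^-1 * g i)%g xi >])%:R -
       (`[< sign_event A' ((g j)^-1 * g i)%g xi >])%:R)) //.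
    apply: eq_bigr => i _; apply: eq_bigr => j _; congr (_ * _).
    by rewrite /signed_indicator rmorphB rmorphM /=.
  apply: eq_bigr => i _; apply: eq_bigr => j _; congr (_ * _).
  by rewrite rmorphB rmorphM /= rmorph_nat.
- by rewrite !sign_prob1; congr (_ %:C)%C; ring.
Qed.

Lemma sign_prob_character A : is_character (fun g => (sign_prob A g)%:C%C).
Proof.
have := @sign_prob_diff_character A A (fun x => id) (fun x y ax nax => False_ind _ (nax ax)).
by congr is_character; apply/funext => g; congr (_%:C)%C; ring.
Qed.

End SignEvents.

(** * Characters that are multiplicative on disjoint supports *)

Section Multiplicative.
Local Open Scope ring_scope.
Set Implicit Arguments.
Unset Strict Implicit.

Section Swap.
Variables M b : nat.

(** For b = i M, conjugation by this involution carries a support contained in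
    the first M points to the interval [(i+1) M, (i+2) M[, which
    produces conjugates with disjoint supports. *)
Definition block_swap_fun (n : nat) : nat :=
  if (n < M)%N then (n + (M + b))%N
  else if (M + b <= n < M + b + M)%N then (n - (M + b))%N else n.

Lemma block_swap_funK : involutive block_swap_fun.
Proof.
move=> n; rewrite {2}/block_swap_fun.
by case: ifP => h1; [|case: ifP => h2]; rewrite /block_swap_fun; repeat case: ifP; lia.
Qed.

Lemma block_swap_fin : finite_set (psupp block_swap_fun).
Proof.
apply: (@sub_finite_set _ _ `I_(M + b + M)); last exact: finite_II.
move=> n /= nn; rewrite ltnNge; apply/negP => le; apply: nn.
by rewrite /block_swap_fun !ifF //; lia.
Qed.

Definition block_swap : 'Fin nat := FinPerm block_swap_funK block_swap_funK block_swap_fin.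
End Swap.

Definition disjoint_supports (g h : 'Fin nat) := forall k, g k = k \/ h k = k.

Lemma block_conj_moved M i (g : 'Fin nat) k : supp_below M g ->
  (block_swap M (i * M) * g * (block_swap M (i * M))^-1)%g k <> k ->
  (i.+1 * M <= k < i.+2 * M)%N.
Proof.
move=> gM; rewrite !finPermM /= => H.
have bk : (block_swap_fun M (i * M) k < M)%N.
  rewrite ltnNge; apply/negP => /gM E; apply: H.
  by rewrite E block_swap_funK.
by move: bk; rewrite /block_swap_fun; repeat case: ifP; rewrite !mulSn; lia.
Qed.

Lemma disjoint_block_conj M i j (g : 'Fin nat) : supp_below M g -> i != j ->
  disjoint_supports (block_swap M (j * M) * g * (block_swap M (j * M))^-1)^-1%g
    (block_swap M (i * M) * g * (block_swap M (i * M))^-1)%g.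
Proof.
move=> gM ij k; pose gs i := (block_swap M (i * M) * g * (block_swap M (i * M))^-1)%g.
rewrite -/(gs i) -/(gs j); set gi := gs i; set gj := gs j.
have [|nj] := pselect (gj k = k).
  by move=> gk; left; rewrite -{1}gk; exact: finPermVK.
have [|ni] := pselect (gi k = k); first by right.
have := block_conj_moved gM nj; have := block_conj_moved gM ni.
move=> /andP[i1 i2] /andP[j1 j2].
have M0 : (0 < M)%N by rewrite lt0n; apply/eqP => M0; move: i2; rewrite M0; lia.
have := leq_ltn_trans i1 j2; have := leq_ltn_trans j1 i2.
by rewrite !ltn_pmul2r //; move/eqP: ij; lia.
Qed.

Context {R : realType}.

(** The quadratic form at 1 and g with coefficients z and 1 is real; taking z = 1
    and z = i gives the two parts of the equality. *)
Lemma character_conjC (G : groupType) (phi : G -> R[i]) g : is_character phi ->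
  phi g^-1%g = (phi g)^*.
Proof.
move=> [_ pos one].
pose x (i : 'I_2) : G := if i == ord0 then g else 1%g.
have Q (z : R[i]) : 0 <= 1 + z * z^* + (z^* * phi g + z * phi g^-1%g).
  have := pos 2 (fun i : 'I_2 => if i == ord0 then 1 else z) x.
  rewrite !big_ord_recl !big_ord0 /x /= mulVg invg1 mul1g mulg1 mulg1 one conjC1 !mulr1 !mul1r !addr0.
  by congr (0 <= _); ring.
have Q1 := Q 1; have Qi := Q 'i%C; move: Q1 Qi.
move: (phi g) (phi g^-1%g) => [a b] [a' b'].
rewrite !lecE /= => /andP[/eqP E1 _] /andP[/eqP Ei _].
apply/eqP; rewrite eq_complex /=.
by apply/andP; split; apply/eqP; lra.
Qed.

(** Both chi_1 and chi_2 are positive on the squares of y - t, where y is the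
    average of N conjugates of g with disjoint supports.  Use t = chi_1(g) for
    chi_1, which is the Cauchy-Schwarz inequality, and t = chi(g) for chi_2; the
    convex combination of the two inequalities is
    r |chi_1(g) - chi(g)|^2 <= (1 - chi(g)^2)/N. *)
Lemma multiplicative_component_eq (chi : 'Fin nat -> R) (chi1 chi2 : 'Fin nat -> R[i]) (r : R) :
  chi 1%g = 1 -> (forall g h, chi (h * g * h^-1)%g = chi g) ->
  (forall g, chi g^-1%g = chi g) ->
  (forall g h, disjoint_supports g h -> chi (g * h)%g = chi g * chi h) ->
  0 < r < 1 -> is_character chi1 -> is_character chi2 ->
  (forall g, (chi g)%:C%C = r%:C%C * chi1 g + (1 - r)%:C%C * chi2 g) ->
  forall g, chi1 g = (chi g)%:C%C.
Proof.
move=> chi_1 chiJ chiV chiM /andP[r0 r1] ch1 ch2 mix g.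
have [M gM] := supp_belowP g.
pose gs i := (block_swap M (i * M) * g * (block_swap M (i * M))^-1)%g.
set c := chi g; set d := chi1 g.
(* The value at y^* y, for y the average of the first N conjugates. *)
pose S (N : nat) (phi : 'Fin nat -> R[i]) : R[i] :=
  N%:R^-1 ^+ 2 * \sum_(i < N) \sum_(j < N) phi ((gs j)^-1 * gs i)%g.
(* Positivity at y - t, expanded; the index 0 carries the unit of the group. *)
have Q (N : nat) phi (t : R[i]) : (0 < N)%N -> is_character phi ->
    0 <= S N phi - t^* * phi g - t * (phi g)^* + t * t^*.
  move=> N0 ch; have := character_pos ch
    (fun i : 'I_N.+1 => if val i is _.+1 then N%:R^-1 else - t)
    (fun i => if val i is k.+1 then gs k else 1%g).
  have N1 : N%:R != 0 :> R[i] by rewrite pnatr_eq0 -lt0n.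
  have phigs k : phi (gs k) = phi g by exact: character_conj ch _ _.
  have phigsV k : phi (gs k)^-1%g = (phi g)^* by rewrite character_conjC // phigs.
  congr (0 <= _).
  rewrite big_ord_recl big_ord_recl /= invg1 mulg1 (character_1 ch) mulr1.
  rewrite [X in _ + X + _ = _](eq_bigr (fun=> - t * N%:R^-1 * (phi g)^*)); last first.
    by move=> k _; rewrite /= mulg1 phigsV fmorphV rmorph_nat.
  rewrite [X in _ + X = _](eq_bigr (fun i : 'I_N => N%:R^-1 * (- t^*) * phi g +
      N%:R^-1 ^+ 2 * \sum_(j < N) phi ((gs j)^-1 * gs i)%g)); last first.
    move=> k _; rewrite big_ord_recl /= invg1 mul1g phigs rmorphN.
    congr (_ + _); rewrite mulr_sumr; apply: eq_bigr => j _.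
    by rewrite /= fmorphV rmorph_nat expr2.
  rewrite big_split /= !sumr_const card_ord -mulr_sumr -/(S N phi) rmorphN /=.
  by rewrite -![(_ * _) *+ N]mulr_natr; field.
(* Off-diagonal terms contribute c^2 and diagonal ones 1. *)
have SN (N : nat) : (0 < N)%N ->
   S N (fun g => (chi g)%:C%C) - (c ^+ 2)%:C%C = (1 - (c ^+ 2)%:C%C) / N%:R.
  move=> N0; have N1 : N%:R != 0 :> R[i] by rewrite pnatr_eq0 -lt0n.
  rewrite /S; set a := (c ^+ 2)%:C%C.
  rewrite (eq_bigr (fun=> a *+ N + (1 - a))); last first.
    move=> i _; rewrite (eq_bigr (fun j => a + (if j == i then 1 - a else 0))).
      by rewrite big_split sumr_const card_ord -big_mkcond big_pred1_eq.
    move=> j _; have [->|ji] := eqVneq j i; first by rewrite mulVg chi_1 addrC subrK.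
    rewrite chiM ?chiV ?chiJ ?addr0 //.
    by apply: disjoint_block_conj; rewrite // eq_sym.
  by rewrite sumr_const card_ord -[(_ + _) *+ N]mulr_natr -[a *+ N]mulr_natr; field.
have Smix (N : nat) : S N (fun g => (chi g)%:C%C) = r%:C%C * S N chi1 + (1 - r)%:C%C * S N chi2.
  rewrite /S mulrCA [X in _ + X]mulrCA -mulrDr; congr (_ * _).
  rewrite !mulr_sumr -big_split; apply: eq_bigr => i _ /=.
  by rewrite !mulr_sumr -big_split; apply: eq_bigr => j _.
have bound (N : nat) : (0 < N)%N -> r%:C%C * ((d - c%:C%C) * (d - c%:C%C)^*) <= N%:R^-1.
  move=> N0; have Q1 := Q N chi1 d N0 ch1; have Q2 := Q N chi2 c%:C%C N0 ch2.
  have rC : 0 <= r%:C%C :> R[i] by rewrite lecR ltW.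
  have rC' : 0 <= (1 - r)%:C%C :> R[i] by rewrite lecR subr_ge0 ltW.
  have := addr_ge0 (mulr_ge0 rC Q1) (mulr_ge0 rC' Q2).
  have cc : (c%:C%C : R[i])^* = c%:C%C by exact: conjc_real.
  have mixg := mix g; have mixg' := congr1 Num.conj mixg.
  have rr (x : R) : (x%:C%C : R[i])^* = x%:C%C by exact: conjc_real.
  rewrite rmorphD !rmorphM /= !rr in mixg'.
  set e := _ + _ => e0; rewrite -subr_ge0.
  have NC : N%:R^-1 = (N%:R^-1 : R)%:C%C :> R[i] by rewrite fmorphV rmorph_nat.
  have -> : N%:R^-1 - r%:C%C * ((d - c%:C%C) * (d - c%:C%C)^*) = e + (c ^+ 2)%:C%C / N%:R.
    have := SN N N0; rewrite Smix => /(canRL (subrK _)).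
    rewrite /e !rmorphB rmorph1 rmorphXn /= !cc -/d.
    rewrite rmorphB rmorph1 /= -/d in mixg'; rewrite rmorphB rmorph1 /= -/d in mixg.
    move: mixg mixg' NC; rewrite -/c => {e e0 Q1 Q2}.
    move: (c%:C%C) (r%:C%C) (S N chi1) (S N chi2) (d^*) (chi2 g) ((chi2 g)^*) (N%:R^-1).
    move=> C s S1 S2 d' d2 d2' k E1 E2 _ E3.
    (* Group the terms so that the three mixing relations can be substituted. *)
    transitivity ((s * S1 + (1 - s) * S2) - s * (d * d') - C * (C - s * d) - C * (C - s * d')
      + (1 - s) * C ^+ 2 + C ^+ 2 * k); first by rewrite E3; ring.
    have -> : C - s * d = (1 - s) * d2 by rewrite E1; ring.
    have -> : C - s * d' = (1 - s) * d2' by rewrite E2; ring.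
    ring.
  by rewrite addr_ge0 // NC -rmorphM lecR /= mulr_ge0 ?sqr_ge0 ?invr_ge0.
have dc : (d - c%:C%C) * (d - c%:C%C)^* = 0.
  have := mul_conjC_ge0 (d - c%:C%C); move: bound; set z := (d - c%:C%C) * (d - c%:C%C)^*.
  case: z => x y H; rewrite lecE /= => /andP[/eqP y0 x0]; rewrite {}y0 in H *.
  have x0' : x <= 0.
    rewrite leNgt; apply/negP => x1.
    have rx : 0 < r * x by exact: mulr_gt0.
    have /H := ltn0Sn (Num.truncn (r * x)^-1).
    rewrite (_ : _^-1 = ((Num.truncn (r * x)^-1).+1%:R^-1 : R)%:C%C); last first.
      by rewrite fmorphV rmorph_nat.
    rewrite -rmorphM lecR /= leNgt => /negP; apply.
    by rewrite invf_plt ?posrE // truncnS_gt.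
  by apply/eqP; rewrite eq_complex /= eqxx andbT eq_le x0'.
by move/eqP: dc; rewrite mul_conjC_eq0 subr_eq0 => /eqP.
Qed.

End Multiplicative.

(** * The full group of signs *)

Section FullGroup.
Local Open Scope ring_scope.
Set Implicit Arguments.
Unset Strict Implicit.

Context {R : realType} (alpha : subprob_seq R).
Implicit Type A : subgroup (S_alpha alpha).

(** For A = S_alpha this is exactly membership in s_xi^{-1}(A). *)
Definition block_respecting (xi : nat -> nat) (g : 'Fin nat) := forall k, g k <> k ->
  xi (g k) = xi k /\ ((0 < xi k)%N && (0 < weight alpha (xi k))).

Section Restriction.
Variables (xi : nat -> nat) (g : 'Fin nat).
Hypothesis gxi : block_respecting xi g.

Lemma block_respecting_stable k : xi (g k) = xi k.
Proof. by have [->//|/gxi[]] := pselect (g k = k). Qed.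

Definition block_restr_fun (f : nat -> nat) (i : nat) (k : nat) := if xi k == i then f k else k.

Lemma block_restr_K (i : nat) : cancel (block_restr_fun g i) (block_restr_fun (fp_inv g) i).
Proof.
move=> k; rewrite {2}/block_restr_fun; case: eqP => [xk|/eqP/negbTE xk]; rewrite /block_restr_fun ?xk //.
by rewrite block_respecting_stable xk eqxx fp_funK.
Qed.

Lemma block_restr_VK (i : nat) : cancel (block_restr_fun (fp_inv g) i) (block_restr_fun g i).
Proof.
move=> k; rewrite {2}/block_restr_fun; case: eqP => [xk|/eqP/negbTE xk]; rewrite /block_restr_fun ?xk //.
by rewrite -(block_respecting_stable (fp_inv g k)) fp_invK xk eqxx.
Qed.

Lemma block_restr_fin (i : nat) : finite_set (psupp (block_restr_fun g i)).
Proof.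
apply: (sub_finite_set _ (fp_fin g)) => k; rewrite /psupp /block_restr_fun /=.
by case: ifP.
Qed.

(** Cutting g along the blocks gives a family that represents it. *)
Definition block_restriction (i : nat) : 'Fin nat :=
  FinPerm (@block_restr_K i) (@block_restr_VK i) (block_restr_fin i).

Lemma block_restrictions_fin :
  finite_set [set i : pos_index alpha | block_restriction (val i) <> 1%g].
Proof.
have /finite_seqP[X XE] := fp_fin g.
apply/(sub_finite_set _ (finite_seq (pmap insub (map xi X)))) => i /= gi.
rewrite mem_pmap_sub; apply: contrapT => iX; apply: gi; apply: finPerm_ext => k /=.
rewrite /block_restr_fun; case: eqP => // xk; apply: contrapT => gk; apply: iX.
apply/mapP; exists k => //; have : psupp g k by [].
by rewrite XE.
Qed.

Definition block_restrictions : dpower (pos_index alpha) ('Fin nat) :=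
  Dpower block_restrictions_fin.

Lemma block_restrictions_family : block_family xi block_restrictions.
Proof.
by move=> i k; rewrite /block /psupp /= /block_restr_fun; case: eqP.
Qed.

Lemma block_restrictions_sum : g =1 block_sum xi block_restrictions.
Proof.
move=> k; rewrite /block_sum; case: insubP => [i _ ik|nk] /=.
  by rewrite /block_restr_fun -ik eqxx.
apply: contrapT => /gxi[_ kpos]; by rewrite kpos in nk.
Qed.
End Restriction.

(** The family representing g is unique: its member of index i agrees with g on the
    i-th block and fixes every other point. *)
Lemma sign_preimageP A (xi : nat -> nat) (g : 'Fin nat) :
  sign_preimage A xi g <->
  exists gxi : block_respecting xi g, subgroup_set A (block_signs (block_restrictions gxi)).
Proof.
split=> [[pi [pix gpi Api]]|[gxi Ag]]; last first.
  exists (block_restrictions gxi); split=> //.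
    exact: block_restrictions_family.
  exact: block_restrictions_sum.
have gxi : block_respecting xi g.
  move=> k; rewrite gpi /block_sum; case: insubP => // i ipos ik _.
  by split; [rewrite -ik; exact: block_family_stable | rewrite -ik; exact: (valP i)].
exists gxi; congr (subgroup_set A _): Api; apply: dpower_ext => i /=; congr sgn.
apply: finPerm_ext => k /=; rewrite /block_restr_fun; case: eqP => xk.
  by rewrite gpi /block_sum xk valK.
by apply: contrapT => /(pix i).
Qed.

Lemma sign_preimage_full A (xi : nat -> nat) g : subgroup_set A = [set: S_alpha alpha] ->
  sign_preimage A xi g <-> block_respecting xi g.
Proof.
by move=> AT; rewrite sign_preimageP; split=> [[]//|gxi]; exists gxi; rewrite AT.
Qed.

(** With disjoint supports, gh respects the blocks exactly when g and h both do,
    and these are events on disjoint sets of coordinates. *)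
Lemma sign_prob_mul A g h : subgroup_set A = [set: S_alpha alpha] ->
  disjoint_supports g h -> sign_prob A (g * h)%g = sign_prob A g * sign_prob A h.
Proof.
move=> AT gh.
have [n gn] := supp_belowP g; have [m hm] := supp_belowP h.
have gk := supp_below_ge (leq_maxl n m) gn; have hk := supp_below_ge (leq_maxr n m) hm.
rewrite /sign_prob -fineM ?fin_num_measure //; try exact: measurable_sign_event.
have XY k : g k != k -> ~~ (h k != k).
  by move=> /eqP gk'; rewrite negbK; apply/eqP; case: (gh k).
rewrite -(depends_on_indep _ XY (depends_on_sign_event (A := A) gk) (depends_on_sign_event (A := A) hk)).
have hgk k : g k <> k -> h k = k by case: (gh k).
have hhk k : h k <> k -> g (h k) = h k.
  move=> hk'; case: (gh (h k)) => // /(can_inj (@fp_funK _ h)) //.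
congr (fine (mu_alpha _ _)); apply/seteqP; split=> xi; rewrite /sign_event /=.
  move=> /(sign_preimage_full _ _ AT) H; split; apply/(sign_preimage_full _ _ AT) => k nk.
    by have := H k; rewrite finPermM (hgk _ nk); apply.
  by have := H k; rewrite finPermM (hhk _ nk); apply.
move=> [/(sign_preimage_full _ _ AT) H1 /(sign_preimage_full _ _ AT) H2].
apply/(sign_preimage_full _ _ AT) => k; rewrite finPermM.
have [hk'|hk'] := pselect (h k = k); first by rewrite hk'; exact: H1.
by rewrite hhk // => _; exact: H2.
Qed.

Lemma sign_probV A g : sign_prob A g^-1%g = sign_prob A g.
Proof.
rewrite /sign_prob; congr (fine (mu_alpha _ _)); apply/seteqP; split=> xi /=.
  by move=> /sign_preimage_V; rewrite invgK.
exact: sign_preimage_V.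
Qed.

Lemma full_indecomposable A : subgroup_set A = [set: S_alpha alpha] ->
  indecomposable_character (fun g => (sign_prob A g)%:C%C).
Proof.
move=> AT; split; first exact: sign_prob_character.
move=> [r [chi1 [chi2 [/andP[r0 r1] ch1 ch2 neq E]]]]; apply: neq.
have comp := multiplicative_component_eq (sign_prob1 A) (fun g h => sign_prob_conj A g h) (sign_probV A)
  (fun g h => @sign_prob_mul A g h AT).
have mix g : (sign_prob A g)%:C%C = r%:C%C * chi1 g + (1 - r)%:C%C * chi2 g.
  by have := congr1 (fun f => f g) E.
apply/funext => g; rewrite (comp chi1 chi2 r) ?r0 //.
rewrite (comp chi2 chi1 (1 - r)) // ?subr_gt0 ?r1 ?gtrBl //.
by move=> h; rewrite (_ : 1 - (1 - r) = r) ?mix 1?addrC //; ring.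
Qed.

End FullGroup.

(** * Proper subgroups of the group of signs *)

Section ProperSubgroups.
Local Open Scope ring_scope.
Set Implicit Arguments.
Unset Strict Implicit.

Context {R : realType} (alpha : subprob_seq R).
Implicit Type A : subgroup (S_alpha alpha).

Lemma pm1P (u : pm1) : u = 1%g \/ u = pm1_sign true.
Proof.
case: u => u uu; have /orP[/eqP u1|/eqP u1] : (u == 1) || (u == -1) by [].
  by left; apply: val_inj.
by right; apply: val_inj.
Qed.

Lemma pm1_sq (u : pm1) : (u * u)%g = 1%g.
Proof. by case: (pm1P u) => ->; apply: val_inj. Qed.

Lemma S_alphaC (s t : S_alpha alpha) : (s * t)%g = (t * s)%g.
Proof. by apply: dpower_ext => i; apply: val_inj; rewrite /= mulrC. Qed.

Lemma S_alpha_sq (s : S_alpha alpha) : (s * s)%g = 1%g.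
Proof. by apply: dpower_ext => i; exact: pm1_sq. Qed.

Section Generator.
Variable i : pos_index alpha.

Lemma generator_fin :
  finite_set [set j : pos_index alpha | (if j == i then pm1_sign true else 1%g) <> 1%g].
Proof.
by apply: (sub_finite_set _ (finite_set1 i)) => j /=; case: eqP.
Qed.
Definition generator : S_alpha alpha := Dpower generator_fin.
End Generator.

(** Induction on the support: multiply by the generators of the indices where the
    sign is -1. *)
Lemma generators_full A : (forall i, subgroup_set A (generator i)) ->
  subgroup_set A = [set: S_alpha alpha].
Proof.
move=> Ag; apply/seteqP; split=> // s _.
have /finite_seqP[X XE] := dpower_fin s.
have : [set j | s j <> 1%g] `<=` [set` X] by rewrite XE.
elim: X {XE} s => [|i X IH] s sX.
  rewrite (_ : s = 1%g); first exact: subgroup_1.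
  by apply: dpower_ext => j; apply: contrapT => /sX.
have As (t : S_alpha alpha) : t i = 1%g -> (forall j, t j <> 1%g -> s j <> 1%g) ->
    subgroup_set A t.
  move=> ti ts; apply: IH => j /= tj; have := sX j (ts j tj).
  by rewrite /= inE => /orP[/eqP ji|//]; rewrite ji in tj.
case: (pm1P (s i)) => si; first exact: As.
have -> : s = (generator i * (generator i * s))%g by rewrite mulgA S_alpha_sq mul1g.
apply: subgroup_M => //; apply: As.
  by rewrite -[LHS]/(generator i i * s i)%g /= eqxx si pm1_sq.
move=> j; rewrite -[dpower_fun (_ * _)%g j]/(generator i j * s j)%g /=.
by case: eqP => [->|_]; [rewrite si|rewrite mul1g].
Qed.

Section Extension.
Variables (A : subgroup (S_alpha alpha)) (s : S_alpha alpha).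

Definition extension_set : set (S_alpha alpha) :=
  [set x | subgroup_set A x \/ subgroup_set A (s * x)%g].

Lemma extension_1 : extension_set 1%g.
Proof. by left; exact: subgroup_1. Qed.

Lemma mulg_translates (x y : S_alpha alpha) : (s * x * (s * y) = x * y)%g.
Proof. by rewrite [(s * x)%g]S_alphaC mulgA -[(x * s * s)%g]mulgA S_alpha_sq mulg1. Qed.

Lemma extension_M x y : extension_set x -> extension_set y -> extension_set (x * y)%g.
Proof.
move=> [Ax|Ax] [Ay|Ay].
- by left; exact: subgroup_M.
- by right; rewrite mulgA [(s * x)%g]S_alphaC -mulgA; exact: subgroup_M.
- by right; rewrite mulgA; exact: subgroup_M.
- by left; rewrite -mulg_translates; exact: subgroup_M.
Qed.

Lemma S_alphaV (x : S_alpha alpha) : x^-1%g = x.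
Proof. by apply: (mulgI x); rewrite mulgV S_alpha_sq. Qed.

Lemma extension_V x : extension_set x -> extension_set x^-1%g.
Proof. by rewrite S_alphaV. Qed.

Definition extension : subgroup (S_alpha alpha) := Subgroup extension_1 extension_M extension_V.

Lemma extension_index2 x y : subgroup_set extension x -> ~ subgroup_set A x ->
  subgroup_set extension y -> ~ subgroup_set A y -> subgroup_set A (x * y)%g.
Proof.
by move=> [//|Ax] _ [//|Ay] _; rewrite -mulg_translates; exact: subgroup_M.
Qed.
End Extension.

Lemma sgn_transposition : sgn (block_swap 1 0) = pm1_sign true.
Proof.
have g2 : supp_below 2 (block_swap 1 0) by move=> [|[|k]].
rewrite (sgnE g2) (_ : perm_trunc g2 = tperm ord0 ord_max) ?odd_tperm //.
apply/permP => k; apply: val_inj; rewrite permE /=.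
by case: tpermP => [->|->|] //; case: k => -[|[|k]] //= kk k0 k1; [case: k0|case: k1]; apply: val_inj.
Qed.

(** When xi sends both 0 and 1 to i, the transposition (0 1) has sign vector the
    generator of index i, which lies in the extension but not in A; this has
    positive probability. *)
Lemma extension_sign_prob_neq A i : ~ subgroup_set A (generator i) ->
  sign_prob A (block_swap 1 0) <> sign_prob (extension A (generator i)) (block_swap 1 0).
Proof.
move=> nA; set g := block_swap 1 0; set A' := extension A _.
pose B := box 2 (fun=> [set val i]).
have mB : measurable B by exact: measurable_box.
have gB xi : B xi -> block_respecting alpha xi g.
  move=> Bxi k; have B0 : xi 0%N = val i := Bxi 0%N isT; have B1 : xi 1%N = val i := Bxi 1%N isT.
  by case: k => [|[|k]] //= _; rewrite ?B0 ?B1; split=> //; exact: (valP i).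
have signs xi (Bxi : B xi) (gxi : block_respecting alpha xi g) :
    block_signs (block_restrictions gxi) = generator i.
  have B0 : xi 0%N = val i := Bxi 0%N isT; have B1 : xi 1%N = val i := Bxi 1%N isT.
  apply: dpower_ext => j /=; case: eqP => ji.
    rewrite -sgn_transposition; congr sgn; apply: finPerm_ext => k /=; rewrite ji /block_restr_fun.
    by case: k => [|[|k]]; rewrite ?B0 ?B1 ?eqxx //; case: ifP.
  rewrite -sgn1; congr sgn; apply: finPerm_ext => k /=; rewrite /block_restr_fun.
  have nij : (val i == val j) = false by apply/eqP => /val_inj ij; apply: ji.
  by case: k => [|[|k]]; rewrite ?B0 ?B1 ?nij //; case: ifP.
have disj : sign_event A g `&` B = set0.
  apply/seteqP; split=> // xi [/sign_preimageP[gxi Ag] Bxi].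
  by rewrite signs // in Ag.
have sub : sign_event A g `|` B `<=` sign_event A' g.
  move=> xi [/sign_preimageP[gxi Ag]|Bxi]; apply/sign_preimageP.
    by exists gxi; left.
  exists (gB _ Bxi); rewrite signs //; right; rewrite S_alpha_sq; exact: subgroup_1.
have PB : (0 < mu_alpha alpha B)%E.
  rewrite /mu_alpha box_prob (eq_bigr (fun=> (weight alpha (val i))%:E)); last first.
    by move=> k _; exact: p_alpha_measureE.
  rewrite prodEFin lte_fin prodr_gt0 // => k _.
  by have /andP[] := valP i.
move=> E; have mA := measurable_sign_event A g; have mA' := measurable_sign_event A' g.
have : (mu_alpha alpha (sign_event A g `|` B) <= mu_alpha alpha (sign_event A' g))%E.
  by apply: le_measure; rewrite ?inE //; exact: measurableU.
rewrite measureU // -(fineK (fin_num_measure _ _ mA')) -[fine _]/(sign_prob A' g) -E.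
rewrite /sign_prob fineK ?fin_num_measure // leNgt => /negP; apply.
by rewrite lteDl // fin_num_measure.
Qed.

Lemma proper_decomposable A i : ~ subgroup_set A (generator i) ->
  ~ indecomposable_character (fun g => (sign_prob A g)%:C%C).
Proof.
move=> nA [_]; apply; set A' := extension A (generator i).
exists (1 / 2), (fun g => (sign_prob A' g)%:C%C),
  (fun g => (2 * sign_prob A g - sign_prob A' g)%:C%C); split.
- by lra.
- exact: sign_prob_character.
- apply: sign_prob_diff_character; first by move=> x Ax; left.
  exact: extension_index2.
- move=> /(congr1 (fun f => f (block_swap 1 0))) [E].
  by apply: (extension_sign_prob_neq nA); rewrite -/A'; lra.
- apply/funext => g; rewrite -!rmorphM -rmorphD; congr (_%:C)%C => /=; lra.
Qed.

End ProperSubgroups.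

Theorem corollary1p8 (R : realType) (alpha : subprob_seq R)
    (A : subgroup (S_alpha alpha)) :
  indecomposable_character (irs_character (nu_alpha A)) <->
  subgroup_set A = [set: S_alpha alpha].
Proof.
rewrite (_ : irs_character _ = (fun g => (sign_prob A g)%:C%C)); last first.
  by apply/funext => g; exact: irs_character_nu_alpha.
split; last exact: full_indecomposable.
move=> ind; apply: generators_full => i; apply: contrapT => nA.
exact: (proper_decomposable nA).
Qed.
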